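(* Let $\beta\ge 0$, $B>0$ and $\epsilon\in(0,1/5)$. There is a constant $C>0$ depending only on $\epsilon,\beta,B,h$ and $D$ such that, for every graph $G$ as in the context with maximum degree $D$ and lattice spacing $h$ and with $n>C$ vertices, $$\frac{\log Z}{n}-F(\beta,B)\ \ge\ -Cn^{-1/5}-C(nh^2)^{-1},$$ and $$\frac{\log Z}{n}-F(\beta,B)\ \le\ \begin{cases} Cn^{-1/5+\epsilon}+Cn^{-4\epsilon/5} & \text{if } \beta B^2\le\theta_c,\\ Cn^{-1/5+\epsilon} & \text{if } \beta B^2>\theta_c.\end{cases}$$
   Context: Let $G=(V,E)$ be a finite undirected graph without self-loops, $n=|V|$, $D$ its maximum degree, and $h>0$ a real number. For $f=(f_x)_{x\in V}\in\mathbb{C}^V$ let $N(f)=\sum_{x\in V}|f_x|^2$ and $$H(f)=\frac{2}{n}\sum_{(x,y)\in E}\Big|\frac{f_x-f_y}{h}\Big|^2-\frac1n\sum_{x\in V}|f_x|^4,$$ where the first sum runs over the edges of $G$, each counted once. Let $df=\prod_{x}df_x$ be Lebesgue measure on $\mathbb{C}^V\cong\mathbb{R}^{2n}$, and $Z=Z(\beta,B)=\int_{\mathbb{C}^V}e^{-\beta H(f)}\mathbf 1_{\{N(f)\le Bn\}}\,df$. For $\theta\ge 2$ let $$m(\theta)=\frac{\theta}{2}-\frac12+\frac{\theta}{2}\sqrt{1-\frac2\theta}+\log\Big(\frac12-\frac12\sqrt{1-\frac2\theta}\Big);$$ $m$ is strictly increasing on $[2,\infty)$ with $m(2)<0<m(3)$,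 and $\theta_c$ denotes its unique zero ($\theta_c\approx 2.455407$). Define $F(\beta,B)=\log(B\pi e)$ if $\beta B^2\le\theta_c$ and $F(\beta,B)=\log(B\pi e)+m(\beta B^2)$ if $\beta B^2>\theta_c$. *)

(* Defs.v *)
From Stdlib Require Import Reals Lra Lia List ClassicalEpsilon.
Import ListNotations.
Open Scope R_scope.

Definition rsum (m : nat) (f : nat -> R) : R :=
  fold_right Rplus 0 (map f (seq 0 m)).

Definition simple_graph (n : nat) (adj : nat -> nat -> bool) : Prop :=
  (forall x y, (x < n)%nat -> (y < n)%nat -> adj x y = adj y x) /\
  (forall x, (x < n)%nat -> adj x x = false).

Definition degree (n : nat) (adj : nat -> nat -> bool) (x : nat) : nat :=
  length (filter (fun y => adj x y) (seq 0 n)).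

Definition max_degree_is (n : nat) (adj : nat -> nat -> bool) (D : nat) : Prop :=
  (forall x, (x < n)%nat -> (degree n adj x <= D)%nat) /\
  (exists x, (x < n)%nat /\ degree n adj x = D).

(* A configuration f in C^V is encoded by c : nat -> R with
   Re f_x = c x and Im f_x = c (n + x), for x < n. *)
Definition abs2 (n : nat) (c : nat -> R) (x : nat) : R :=
  c x ^ 2 + c (n + x)%nat ^ 2.

Definition Nmass (n : nat) (c : nat -> R) : R := rsum n (abs2 n c).

(* each edge {x,y} counted once, as the pair x < y *)
Definition Hamil (n : nat) (adj : nat -> nat -> bool) (h : R) (c : nat -> R) : R :=
  2 / INR n *
    rsum n (fun x => rsum n (fun y =>
      if (Nat.ltb x y && adj x y)%bool then
        ((c x - c y) ^ 2 + (c (n + x)%nat - c (n + y)%nat) ^ 2) / h ^ 2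
      else 0))
  - 1 / INR n * rsum n (fun x => abs2 n c x ^ 2).

Definition integrand (n : nat) (adj : nat -> nat -> bool) (h beta B : R)
  (c : nat -> R) : R :=
  if Rle_dec (Nmass n c) (B * INR n) then exp (- beta * Hamil n adj h c) else 0.

Fixpoint gridsum (d m : nat) (g : (nat -> nat) -> R) : R :=
  match d with
  | O => g (fun _ => O)
  | S d' => rsum m (fun j =>
      gridsum d' m (fun p => g (fun i => if Nat.eqb i d' then j else p i)))
  end.

(* half side of a box [-K,K]^(2n) containing the ball {N <= B n} *)
Definition boxK (n : nat) (B : R) : nat := S (Z.to_nat (up (B * INR n))).

Definition riemann_sum (n : nat) (adj : nat -> nat -> bool) (h beta B : R)
  (k : nat) : R :=
  let K := boxK n B in
  (/ INR (S k)) ^ (2 * n) *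
  gridsum (2 * n) (2 * S k * K)
    (fun p => integrand n adj h beta B
       (fun i => - INR K + (INR (p i) + / 2) / INR (S k))).

(* Z(beta,B) = integral over C^V = R^(2n) of e^{-beta H} 1_{N <= B n}
   (a bounded, Riemann integrable function supported in the box), realised as
   the limit of its midpoint Riemann sums. *)
Definition Zpart (n : nat) (adj : nat -> nat -> bool) (h beta B : R) : R :=
  epsilon (inhabits 0) (fun z => Un_cv (riemann_sum n adj h beta B) z).

Definition mfun (t : R) : R :=
  t / 2 - 1 / 2 + t / 2 * sqrt (1 - 2 / t)
  + ln (1 / 2 - 1 / 2 * sqrt (1 - 2 / t)).

(* theta_c : the unique zero of m on [2, oo) *)
Definition theta_c : R := epsilon (inhabits 0) (fun t => 2 <= t /\ mfun t = 0).

Definition Ffree (beta B : R) : R :=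
  if Rle_dec (beta * B ^ 2) theta_c then ln (B * PI * exp 1)
  else ln (B * PI * exp 1) + mfun (beta * B ^ 2).

(* Main.v *)
(* On the ball [N <= B n] the gradient term contributes only O(1) to the exponent, so everything
   is governed by the quartic term, which is large only if O(sqrt n) sites carry a positive
   fraction [a] of the mass.  Giving those sites mass [a B n] gains [theta a^2] with
   [theta = beta B^2], and confining the remaining sites to a ball of radius [B n (1 - a)] costs
   [ln (1 - a)]; [F - ln (B pi e)] is the supremum of [theta a^2 + ln (1 - a)] over [0 <= a < 1].
   For the upper bound the integrand is dominated pointwise by a sum of [n] product functions (one
   for each value of [a] on a grid of mesh [1/n]); for the lower bound one site is localised and
   the indicator for the others is bounded below by a Chernoff combination of Gaussians.  In both
   cases only one-dimensional Gaussian integrals remain.  All errors are O(n^(-1/2) ln n), and the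
   midpoint sums converge because the integrand is Lipschitz away from thin shells around the
   sphere [N = B n]. *)
Require Import Defs.
From Stdlib Require Import Reals Ranalysis5 ZArith Lra Lia List ClassicalEpsilon FunctionalExtensionality.
From Coquelicot Require Import Coquelicot.
Open Scope R_scope.

(** * Finite sums, products and grid sums *)

(** [Zpart] is accessible only as a limit of midpoint sums, so each bound is proved for the sums and
    carried to the limit. A grid sum factors into one-dimensional sums only for a product over
    coordinates, which the cut-off integrand is not; hence the comparison with products on both
    sides. In the upper bound a site counts as large when |f_x|^2 exceeds sqrt n. This balances two
    costs: at most B sqrt n sites are large, each paying a factor n^6, and the small sites add at
    most beta B sqrt n to the exponent. In the lower bound the window kept for the mass of the other
    sites has relative width of order n^(-1/2), the scale on which a sum of n squared Gaussians
    fluctuates, so it costs only O(sqrt n) in the exponent. Since n^(-1/2) ln n is O(n^(-1/5)), both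
    bounds end at the rate n^(-1/5). *)

Lemma rsum_0 (f : nat -> R) : rsum 0 f = 0.
Proof. reflexivity. Qed.

Lemma rsum_S (m : nat) (f : nat -> R) : rsum (S m) f = rsum m f + f m.
Proof.
  unfold rsum. rewrite seq_S, map_app, fold_right_app. simpl.
  rewrite Rplus_0_r.
  assert (H : forall l a, fold_right Rplus a l = fold_right Rplus 0 l + a).
  { induction l as [|x l IH]; intros a; simpl; [lra|]. rewrite IH. lra. }
  apply H.
Qed.

Lemma rsum_ext (m : nat) (f g : nat -> R) :
  (forall i, (i < m)%nat -> f i = g i) -> rsum m f = rsum m g.
Proof.
  induction m as [|m IH]; intros H; [reflexivity|].
  rewrite !rsum_S, IH; [|intros; apply H; lia]. rewrite H; [reflexivity|lia].
Qed.

Lemma rsum_le (m : nat) (f g : nat -> R) :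
  (forall i, (i < m)%nat -> f i <= g i) -> rsum m f <= rsum m g.
Proof.
  induction m as [|m IH]; intros H; [rewrite !rsum_0; lra|].
  rewrite !rsum_S. apply Rplus_le_compat; [apply IH; intros|]; apply H; lia.
Qed.

Lemma rsum_const (m : nat) (a : R) : rsum m (fun _ => a) = INR m * a.
Proof.
  induction m as [|m IH]; [rewrite rsum_0; simpl; lra|].
  rewrite rsum_S, IH, S_INR. lra.
Qed.

Lemma rsum_nonneg (m : nat) (f : nat -> R) :
  (forall i, (i < m)%nat -> 0 <= f i) -> 0 <= rsum m f.
Proof.
  intros H. apply Rle_trans with (rsum m (fun _ => 0)).
  - rewrite rsum_const. lra.
  - apply rsum_le, H.
Qed.

Lemma rsum_plus (m : nat) (f g : nat -> R) :
  rsum m (fun i => f i + g i) = rsum m f + rsum m g.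
Proof.
  induction m as [|m IH]; [rewrite !rsum_0; lra|]. rewrite !rsum_S, IH. lra.
Qed.

Lemma rsum_scal (m : nat) (a : R) (f : nat -> R) :
  rsum m (fun i => a * f i) = a * rsum m f.
Proof.
  induction m as [|m IH]; [rewrite !rsum_0; lra|]. rewrite !rsum_S, IH. lra.
Qed.

Lemma rsum_term_le (m : nat) (f : nat -> R) (i : nat) :
  (i < m)%nat -> (forall j, (j < m)%nat -> 0 <= f j) -> f i <= rsum m f.
Proof.
  induction m as [|m IH]; intros Hi H; [lia|].
  rewrite rsum_S. destruct (Nat.eq_dec i m) as [->|Hne].
  - assert (0 <= rsum m f) by (apply rsum_nonneg; intros; apply H; lia). lra.
  - assert (0 <= f m) by (apply H; lia).
    assert (f i <= rsum m f) by (apply IH; [lia|intros; apply H; lia]). lra.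
Qed.

Lemma rsum_add (a b : nat) (f : nat -> R) :
  rsum (a + b) f = rsum a f + rsum b (fun i => f (a + i)%nat).
Proof.
  induction b as [|b IH]; [rewrite Nat.add_0_r, rsum_0; lra|].
  rewrite Nat.add_succ_r, !rsum_S, IH. lra.
Qed.

Lemma rsum_mul (m L : nat) (f : nat -> R) :
  rsum (m * L) f = rsum m (fun j => rsum L (fun r => f (j * L + r)%nat)).
Proof.
  induction m as [|m IH]; [reflexivity|].
  rewrite rsum_S, <- IH. replace (S m * L)%nat with (m * L + L)%nat by lia.
  apply rsum_add.
Qed.

Lemma rsum_swap (a b : nat) (f : nat -> nat -> R) :
  rsum a (fun i => rsum b (f i)) = rsum b (fun j => rsum a (fun i => f i j)).
Proof.
  induction a as [|a IH].
  - rewrite rsum_0. symmetry. rewrite (rsum_ext b _ (fun _ => 0)); [|reflexivity].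
    rewrite rsum_const. lra.
  - rewrite rsum_S, IH, <- rsum_plus. apply rsum_ext. intros. rewrite rsum_S. reflexivity.
Qed.

Lemma rsum_first (m : nat) (f : nat -> R) :
  rsum (S m) f = f O + rsum m (fun i => f (S i)).
Proof.
  change (S m) with (1 + m)%nat. rewrite rsum_add, rsum_S, rsum_0. simpl. lra.
Qed.

(** Serves the large sites: for a given total mass the quartic sum is largest when one site carries
    all of it. *)
Lemma rsum_sq_le (m : nat) (f : nat -> R) :
  (forall i, (i < m)%nat -> 0 <= f i) -> rsum m (fun i => f i ^ 2) <= rsum m f ^ 2.
Proof.
  induction m as [|m IH]; intros H; [rewrite !rsum_0; lra|].
  rewrite !rsum_S.
  assert (0 <= rsum m f) by (apply rsum_nonneg; intros; apply H; lia).
  assert (0 <= f m) by (apply H; lia).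
  assert (rsum m (fun i => f i ^ 2) <= rsum m f ^ 2) by (apply IH; intros; apply H; lia).
  nra.
Qed.

(** * Finite products *)

Fixpoint rprod (m : nat) (f : nat -> R) : R :=
  match m with O => 1 | S m' => rprod m' f * f m' end.

Lemma rprod_ext (m : nat) (f g : nat -> R) :
  (forall i, (i < m)%nat -> f i = g i) -> rprod m f = rprod m g.
Proof.
  induction m as [|m IH]; intros H; [reflexivity|]. simpl.
  rewrite IH; [|intros; apply H; lia]. rewrite H; [reflexivity|lia].
Qed.

Lemma rprod_const (m : nat) (a : R) : rprod m (fun _ => a) = a ^ m.
Proof. induction m as [|m IH]; simpl; [reflexivity|]. rewrite IH. lra. Qed.

Lemma rprod_add (a b : nat) (f : nat -> R) :
  rprod (a + b) f = rprod a f * rprod b (fun i => f (a + i)%nat).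
Proof.
  induction b as [|b IH]; simpl; [rewrite Nat.add_0_r; lra|].
  rewrite Nat.add_succ_r. simpl. rewrite IH. lra.
Qed.

Lemma rprod_mult (m : nat) (f g : nat -> R) :
  rprod m (fun i => f i * g i) = rprod m f * rprod m g.
Proof. induction m as [|m IH]; simpl; [lra|]. rewrite IH. lra. Qed.

Lemma rprod_exp (m : nat) (f : nat -> R) :
  rprod m (fun i => exp (f i)) = exp (rsum m f).
Proof.
  induction m as [|m IH]; [rewrite rsum_0, exp_0; reflexivity|].
  simpl. rewrite IH, rsum_S, exp_plus. reflexivity.
Qed.

Lemma rprod_le (m : nat) (f g : nat -> R) :
  (forall i, (i < m)%nat -> 0 <= f i <= g i) -> 0 <= rprod m f <= rprod m g.
Proof.
  induction m as [|m IH]; intros H; simpl; [lra|].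
  assert (H1 : 0 <= rprod m f <= rprod m g) by (apply IH; intros; apply H; lia).
  assert (H2 : 0 <= f m <= g m) by (apply H; lia).
  split; [apply Rmult_le_pos; lra|apply Rmult_le_compat; lra].
Qed.

Lemma rprod_nonneg (m : nat) (f : nat -> R) :
  (forall i, (i < m)%nat -> 0 <= f i) -> 0 <= rprod m f.
Proof. intros H. apply (rprod_le m f f). intros i Hi. split; [apply H, Hi|apply Rle_refl]. Qed.

(** * Grid sums *)

Lemma gridsum_S (d m : nat) (g : (nat -> nat) -> R) :
  gridsum (S d) m g = rsum m (fun j =>
      gridsum d m (fun p => g (fun i => if Nat.eqb i d then j else p i))).
Proof. reflexivity. Qed.

(** The index maps are bounded in every coordinate, also beyond [d], so that grid points satisfy
    [inbox] below. The base case evaluates at the constant map 0, hence [0 < m]. *)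
Lemma gridsum_le (d m : nat) (f g : (nat -> nat) -> R) :
  (0 < m)%nat ->
  (forall p, (forall i, (p i < m)%nat) -> f p <= g p) -> gridsum d m f <= gridsum d m g.
Proof.
  intros Hm. revert f g. induction d as [|d IH]; intros f g H.
  - apply H. intros; lia.
  - rewrite !gridsum_S. apply rsum_le. intros j Hj. apply IH. intros p Hp. apply H.
    intros i. destruct (Nat.eqb i d); auto.
Qed.

Lemma gridsum_ext (d m : nat) (f g : (nat -> nat) -> R) :
  (0 < m)%nat ->
  (forall p, (forall i, (p i < m)%nat) -> f p = g p) -> gridsum d m f = gridsum d m g.
Proof.
  intros Hm H. apply Rle_antisym; apply gridsum_le; auto; intros p Hp; rewrite H; auto; lra.
Qed.

Lemma gridsum_plus (d m : nat) (f g : (nat -> nat) -> R) :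
  gridsum d m (fun p => f p + g p) = gridsum d m f + gridsum d m g.
Proof.
  revert f g. induction d as [|d IH]; intros f g; [reflexivity|].
  rewrite !gridsum_S, <- rsum_plus. apply rsum_ext. intros j _.
  exact (IH (fun p => f (fun i => if Nat.eqb i d then j else p i))
            (fun p => g (fun i => if Nat.eqb i d then j else p i))).
Qed.

Lemma gridsum_scal (d m : nat) (a : R) (f : (nat -> nat) -> R) :
  gridsum d m (fun p => a * f p) = a * gridsum d m f.
Proof.
  revert f. induction d as [|d IH]; intros f; [reflexivity|].
  rewrite !gridsum_S, <- rsum_scal. apply rsum_ext. intros j _.
  exact (IH (fun p => f (fun i => if Nat.eqb i d then j else p i))).
Qed.

Lemma gridsum_const (d m : nat) (a : R) : gridsum d m (fun _ => a) = INR m ^ d * a.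
Proof.
  induction d as [|d IH]; [simpl; lra|].
  rewrite gridsum_S, IH, rsum_const. simpl. lra.
Qed.

Lemma gridsum_abs (d m : nat) (f : (nat -> nat) -> R) :
  (0 < m)%nat -> Rabs (gridsum d m f) <= gridsum d m (fun p => Rabs (f p)).
Proof.
  intros Hm. apply Rabs_le. split.
  - replace (- gridsum d m (fun p => Rabs (f p)))
      with (gridsum d m (fun p => -1 * Rabs (f p))) by (rewrite gridsum_scal; lra).
    apply gridsum_le; auto. intros p _.
    pose proof (Rle_abs (- f p)) as H. rewrite Rabs_Ropp in H. lra.
  - apply gridsum_le; auto. intros p _. apply Rle_abs.
Qed.

Lemma gridsum_rsum (d m l : nat) (f : nat -> (nat -> nat) -> R) :
  gridsum d m (fun p => rsum l (fun j => f j p)) = rsum l (fun j => gridsum d m (f j)).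
Proof.
  induction l as [|l IH].
  - rewrite rsum_0. change (gridsum d m (fun _ => 0) = 0). rewrite gridsum_const. lra.
  - rewrite rsum_S, <- IH, <- gridsum_plus. f_equal. apply functional_extensionality.
    intros p. apply rsum_S.
Qed.

(** Discrete Fubini: this is what reduces everything to one-dimensional integrals. *)
Lemma gridsum_rprod (d m : nat) (u : nat -> nat -> R) :
  gridsum d m (fun p => rprod d (fun i => u i (p i))) = rprod d (fun i => rsum m (u i)).
Proof.
  induction d as [|d IH]; [reflexivity|].
  rewrite gridsum_S. simpl. rewrite <- IH, Rmult_comm, (Rmult_comm (rsum m (u d))), <- rsum_scal.
  apply rsum_ext. intros j _. rewrite Rmult_comm, <- gridsum_scal. f_equal.
  apply functional_extensionality. intros p.
  rewrite Nat.eqb_refl, Rmult_comm. f_equal. apply rprod_ext. intros i Hi.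
  destruct (Nat.eqb_spec i d) as [->|]; [lia|reflexivity].
Qed.

(** Division with remainder in each coordinate: [p] selects a coarse cell and [q] one of its L^d
    subcells. *)
Lemma gridsum_refine (d m L : nat) (g : (nat -> nat) -> R) :
  gridsum d (m * L) g =
  gridsum d m (fun p => gridsum d L (fun q => g (fun i => (p i * L + q i)%nat))).
Proof.
  revert g. induction d as [|d IH]; intros g; [reflexivity|].
  rewrite !gridsum_S, rsum_mul. apply rsum_ext. intros j _.
  transitivity (gridsum d m (fun p => rsum L (fun r => gridsum d L (fun q =>
    g (fun i => if Nat.eqb i d then (j * L + r)%nat else (p i * L + q i)%nat))))).
  - rewrite gridsum_rsum. apply rsum_ext. intros r _. rewrite IH. reflexivity.
  - f_equal. apply functional_extensionality. intros p. rewrite gridsum_S.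
    apply rsum_ext. intros r _. f_equal. apply functional_extensionality. intros q.
    f_equal. apply functional_extensionality. intros i.
    destruct (Nat.eqb i d); reflexivity.
Qed.

(** * Convergence of the midpoint sums *)

Lemma count_le (m : nat) (a c : R) :
  a <= c ->
  rsum m (fun j => if Rle_dec a (INR j) then if Rle_dec (INR j) c then 1 else 0 else 0)
  <= c - a + 1.
Proof.
  intros Hac. set (f := fun j => _).
  (* Form that survives the induction: only integers up to m - 1 have been seen, and the count is 0
     until [a] is reached. *)
  assert (H : rsum m f <= Rmax 0 (Rmin c (INR m - 1) - a + 1)).
  { induction m as [|m IH]; [rewrite rsum_0; apply Rmax_l|].
    rewrite rsum_S, S_INR. unfold f at 2.
    destruct (Rle_dec a (INR m)); [destruct (Rle_dec (INR m) c)|];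
    revert IH; unfold Rmax, Rmin; repeat destruct Rle_dec; lra. }
  revert H. unfold Rmax, Rmin; repeat destruct Rle_dec; lra.
Qed.

Lemma count_ge (m : nat) (a c : R) :
  0 <= a -> c <= INR m ->
  c - a - 1 <=
  rsum m (fun j => if Rle_dec a (INR j) then if Rle_dec (INR j) c then 1 else 0 else 0).
Proof.
  intros Ha Hc. set (f := fun j => _).
  assert (Hf : forall j, 0 <= f j).
  { intros j. unfold f. repeat destruct Rle_dec; lra. }
  assert (H : Rmin c (INR m) - a - 1 <= rsum m f).
  { clear Hc. induction m as [|m IH].
    - rewrite rsum_0. simpl. unfold Rmin. destruct Rle_dec; lra.
    - assert (H0 : 0 <= rsum m f) by (apply rsum_nonneg; intros; apply Hf).
      rewrite rsum_S, S_INR. unfold f at 2.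
      destruct (Rle_dec a (INR m)); [destruct (Rle_dec (INR m) c)|];
      revert IH; unfold Rmin; repeat destruct Rle_dec; lra. }
  rewrite Rmin_left in H; lra.
Qed.

(** * Bounded Lipschitz functions on a box *)

Definition inbox (K : R) (v : nat -> R) : Prop := forall i, Rabs (v i) <= K.

(** Lipschitz for the sup distance. The bound on the values is part of the notion because products
    of Lipschitz functions need it. *)
Definition tame (K : R) (f : (nat -> R) -> R) : Prop :=
  exists L, 0 <= L /\
    (forall v, inbox K v -> Rabs (f v) <= L) /\
    (forall v v' w, inbox K v -> inbox K v' -> (forall i, Rabs (v i - v' i) <= w) ->
       Rabs (f v - f v') <= L * w).

Lemma dist_nonneg (v v' : nat -> R) (w : R) :
  (forall i, Rabs (v i - v' i) <= w) -> 0 <= w.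
Proof. intros H. eapply Rle_trans; [apply Rabs_pos|apply (H O)]. Qed.

Lemma tame_const (K a : R) : tame K (fun _ => a).
Proof.
  exists (Rabs a). split; [apply Rabs_pos|]. split; [intros; lra|].
  intros v v' w _ _ H. apply dist_nonneg in H. rewrite Rminus_diag, Rabs_R0.
  apply Rmult_le_pos; [apply Rabs_pos|assumption].
Qed.

Lemma tame_coord (K : R) (i : nat) : 0 <= K -> tame K (fun v => v i).
Proof.
  intros HK. exists (K + 1). split; [lra|]. split.
  - intros v Hv. specialize (Hv i). lra.
  - intros v v' w _ _ H. pose proof (dist_nonneg _ _ _ H). specialize (H i). nra.
Qed.

Lemma tame_plus (K : R) (f g : (nat -> R) -> R) :
  tame K f -> tame K g -> tame K (fun v => f v + g v).
Proof.
  intros (L & HL & Hb & Hl) (L' & HL' & Hb' & Hl'). exists (L + L').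
  split; [lra|]. split.
  - intros v Hv. eapply Rle_trans; [apply Rabs_triang|].
    specialize (Hb v Hv). specialize (Hb' v Hv). lra.
  - intros v v' w Hv Hv' Hw.
    replace (f v + g v - (f v' + g v')) with ((f v - f v') + (g v - g v')) by lra.
    eapply Rle_trans; [apply Rabs_triang|].
    specialize (Hl v v' w Hv Hv' Hw). specialize (Hl' v v' w Hv Hv' Hw). lra.
Qed.

Lemma tame_mult (K : R) (f g : (nat -> R) -> R) :
  tame K f -> tame K g -> tame K (fun v => f v * g v).
Proof.
  intros (L & HL & Hb & Hl) (L' & HL' & Hb' & Hl'). exists (2 * (L * L')).
  assert (HLL : 0 <= L * L') by (apply Rmult_le_pos; lra).
  split; [lra|]. split.
  - intros v Hv. rewrite Rabs_mult.
    specialize (Hb v Hv). specialize (Hb' v Hv).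
    assert (Rabs (f v) * Rabs (g v) <= L * L')
      by (apply Rmult_le_compat; auto using Rabs_pos). lra.
  - intros v v' w Hv Hv' Hw.
    replace (f v * g v - f v' * g v') with ((f v - f v') * g v + f v' * (g v - g v')) by lra.
    eapply Rle_trans; [apply Rabs_triang|]. rewrite !Rabs_mult.
    assert (Rabs (f v - f v') * Rabs (g v) <= (L * w) * L')
      by (apply Rmult_le_compat; auto using Rabs_pos).
    assert (Rabs (f v') * Rabs (g v - g v') <= L * (L' * w))
      by (apply Rmult_le_compat; auto using Rabs_pos). lra.
Qed.

Lemma tame_scal (K a : R) (f : (nat -> R) -> R) : tame K f -> tame K (fun v => a * f v).
Proof. apply tame_mult, tame_const. Qed.

Lemma tame_minus (K : R) (f g : (nat -> R) -> R) :
  tame K f -> tame K g -> tame K (fun v => f v - g v).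
Proof.
  intros Hf Hg. pose proof (tame_plus K f _ Hf (tame_scal K (-1) g Hg)) as H.
  replace (fun v => f v - g v) with (fun v => f v + -1 * g v); [exact H|].
  apply functional_extensionality. intros. lra.
Qed.

Lemma tame_pow (K : R) (k : nat) (f : (nat -> R) -> R) : tame K f -> tame K (fun v => f v ^ k).
Proof.
  intros Hf. induction k as [|k IH]; [apply (tame_const K 1)|]. apply (tame_mult K f (fun v => f v ^ k)); assumption.
Qed.

Lemma tame_rsum (K : R) (m : nat) (F : (nat -> R) -> nat -> R) :
  (forall i, tame K (fun v => F v i)) -> tame K (fun v => rsum m (F v)).
Proof.
  intros H. induction m as [|m IH]; [apply (tame_const K 0)|].
  replace (fun v => rsum (S m) (F v)) with (fun v => rsum m (F v) + F v m).
  - apply tame_plus; auto.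
  - apply functional_extensionality. intros. rewrite rsum_S. reflexivity.
Qed.

Lemma exp_le_compat (a b : R) : a <= b -> exp a <= exp b.
Proof. intros [H| ->]; [left; apply exp_increasing|right]; auto. Qed.

Lemma exp_sub_le (a b : R) : exp a - exp b <= exp a * (a - b).
Proof.
  pose proof (exp_ineq1_le (b - a)). pose proof (exp_pos a).
  replace (exp b) with (exp a * exp (b - a)) by (rewrite <- exp_plus; f_equal; lra). nra.
Qed.

Lemma exp_lipschitz (a b M : R) :
  a <= M -> b <= M -> Rabs (exp a - exp b) <= exp M * Rabs (a - b).
Proof.
  intros Ha Hb.
  assert (H : forall x y, x <= M -> exp x - exp y <= exp M * Rabs (x - y)).
  { intros x y Hx. eapply Rle_trans; [apply exp_sub_le|].
    assert (exp x <= exp M) by (apply exp_le_compat, Hx).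
    pose proof (exp_pos x). pose proof (Rle_abs (x - y)). pose proof (Rabs_pos (x - y)). nra. }
  apply Rabs_le. split; [|apply H; auto].
  specialize (H b a Hb). rewrite Rabs_minus_sym in H. lra.
Qed.

Lemma tame_exp (K : R) (f : (nat -> R) -> R) : tame K f -> tame K (fun v => exp (f v)).
Proof.
  intros (L & HL & Hb & Hl). exists (exp L * (1 + L)).
  pose proof (exp_pos L) as HeL.
  assert (HM : forall v, inbox K v -> f v <= L).
  { intros v Hv. eapply Rle_trans; [apply Rle_abs|auto]. }
  split; [nra|]. split.
  - intros v Hv. rewrite Rabs_right; [|left; apply exp_pos].
    assert (exp (f v) <= exp L) by (apply exp_le_compat; auto).
    nra.
  - intros v v' w Hv Hv' Hw. eapply Rle_trans; [apply (exp_lipschitz _ _ L); auto|].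
    specialize (Hl v v' w Hv Hv' Hw). pose proof (dist_nonneg _ _ _ Hw). nra.
Qed.

(** The shape of [integrand], to which it is convertible for [Q] the mass and [E] equal to - beta
    H. *)
Definition cut_exp (R0 : R) (Q E : (nat -> R) -> R) (v : nat -> R) : R :=
  if Rle_dec (Q v) R0 then exp (E v) else 0.

(* A Lipschitz density cut off along [Q = R0] oscillates by O(1) only in the shell
   [|Q - R0| = O(w)]. *)
Lemma cut_exp_osc (K R0 : R) (Q E : (nat -> R) -> R) :
  tame K Q -> tame K E ->
  exists L, 0 <= L /\ forall v v' w, inbox K v -> inbox K v' ->
    (forall i, Rabs (v i - v' i) <= w) ->
    Rabs (cut_exp R0 Q E v - cut_exp R0 Q E v') <=
      L * w + L * (if Rle_dec (Rabs (Q v - R0)) (L * w) then 1 else 0).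
Proof.
  intros (L1 & HL1 & _ & Hl1) HE.
  destruct (tame_exp _ _ HE) as (L2 & HL2 & Hb2 & Hl2).
  exists (L1 + L2). split; [lra|]. intros v v' w Hv Hv' Hw.
  pose proof (dist_nonneg _ _ _ Hw) as Hw0.
  specialize (Hl1 v v' w Hv Hv' Hw). specialize (Hl2 v v' w Hv Hv' Hw).
  pose proof (Hb2 v Hv) as Hbv. pose proof (Hb2 v' Hv') as Hbv'.
  assert (H1 : 0 <= L1 * w) by (apply Rmult_le_pos; lra).
  assert (H2 : 0 <= L2 * w) by (apply Rmult_le_pos; lra).
  unfold cut_exp. apply Rabs_le_between in Hl1.
  (* If the two points lie on opposite sides of the level set, then |Q v - R0| <= L1 w and the
     difference is a single value of the exponential, at most L2. *)
  destruct (Rle_dec (Q v) R0); destruct (Rle_dec (Q v') R0);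
    destruct (Rle_dec (Rabs (Q v - R0)) ((L1 + L2) * w)) as [Hs|Hs];
    rewrite ?Rminus_0_r, ?Rminus_0_l, ?Rabs_Ropp, ?Rminus_diag, ?Rabs_R0;
    try lra; exfalso; apply Hs; apply Rabs_le; lra.
Qed.

(** * Midpoint sums under refinement of the grid *)

Definition gpt (K k : nat) (p : nat -> nat) (i : nat) : R :=
  - INR K + (INR (p i) + / 2) / INR (S k).

Definition rsm (d K : nat) (g : (nat -> R) -> R) (k : nat) : R :=
  (/ INR (S k)) ^ d * gridsum d (2 * S k * K) (fun p => g (gpt K k p)).

Lemma INR_S_pos (k : nat) : 0 < INR (S k).
Proof. apply lt_0_INR. lia. Qed.

Lemma gpt_inbox (K k : nat) (p : nat -> nat) :
  (forall i, (p i < 2 * S k * K)%nat) -> inbox (INR K) (gpt K k p).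
Proof.
  intros Hp i. specialize (Hp i). unfold gpt.
  pose proof (INR_S_pos k) as Hk. pose proof (pos_INR (p i)) as H0.
  assert (H1 : INR (p i) + 1 <= 2 * INR (S k) * INR K).
  { rewrite <- S_INR. replace 2 with (INR 2) by reflexivity. rewrite <- !mult_INR.
    apply le_INR. lia. }
  assert (H2 : 0 <= (INR (p i) + / 2) / INR (S k) <= 2 * INR K).
  { split; [apply Rdiv_le_0_compat; lra|apply Rle_div_l; lra]. }
  apply Rabs_le. lra.
Qed.

Lemma gpt_refine (K k l k' : nat) (p q : nat -> nat) (i : nat) :
  S k' = (S k * S l)%nat -> (q i < S l)%nat ->
  Rabs (gpt K k p i - gpt K k' (fun i => (p i * S l + q i)%nat) i) <= / INR (S k).
Proof.
  intros Hk' Hq. unfold gpt. rewrite Hk', plus_INR, !mult_INR.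
  pose proof (INR_S_pos k) as Hk. pose proof (INR_S_pos l) as Hl.
  pose proof (pos_INR (q i)) as H0.
  assert (H1 : INR (q i) + 1 <= INR (S l)) by (rewrite <- S_INR; apply le_INR; lia).
  set (x := INR (S k)) in *. set (y := INR (S l)) in *.
  replace (_ - _) with ((/ 2 - (INR (q i) + / 2) / y) * / x) by (field; lra).
  rewrite Rabs_mult, (Rabs_right (/ x)); [|left; apply Rinv_0_lt_compat; lra].
  assert (0 <= (INR (q i) + / 2) / y <= 1).
  { split; [apply Rdiv_le_0_compat; lra|apply Rle_div_l; lra]. }
  assert (0 < / x) by (apply Rinv_0_lt_compat; lra).
  assert (Rabs (/ 2 - (INR (q i) + / 2) / y) <= 1) by (apply Rabs_le; lra). nra.
Qed.

Lemma sqrt_diff_le (a b : R) : 0 <= b <= a -> sqrt a <= sqrt b + sqrt (a - b).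
Proof.
  intros H. apply Rsqr_incr_0_var.
  - rewrite Rsqr_sqrt by lra. unfold Rsqr.
    pose proof (sqrt_sqrt b ltac:(lra)). pose proof (sqrt_sqrt (a - b) ltac:(lra)).
    pose proof (sqrt_pos b). pose proof (sqrt_pos (a - b)). nra.
  - pose proof (sqrt_pos b). pose proof (sqrt_pos (a - b)). lra.
Qed.

(** The condition confines |y| to an interval [lo, hi] with hi^2 - lo^2 <= 2 s, so its length is at
    most sqrt (2 s) whatever [a] is. Each sign of y then gives at most sqrt (2 s) * S k + 1 grid
    points. *)
Lemma coord_shell_le (K k m : nat) (a s : R) :
  0 <= s ->
  rsum m (fun j =>
    if Rle_dec (Rabs ((- INR K + (INR j + / 2) / INR (S k)) ^ 2 - a)) s then 1 else 0)
  <= 2 * (sqrt (2 * s) * INR (S k)) + 2.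
Proof.
  intros Hs. pose proof (INR_S_pos k) as Hk. set (x := INR (S k)) in *.
  pose proof (sqrt_pos (2 * s)) as Hsq.
  assert (Hnn : 0 <= sqrt (2 * s) * x) by (apply Rmult_le_pos; lra).
  destruct (Rlt_le_dec (a + s) 0) as [Hneg|Hpos].
  { rewrite (rsum_ext _ _ (fun _ => 0)); [rewrite rsum_const; lra|].
    intros j _. destruct Rle_dec as [H|H]; [|reflexivity]. apply Rabs_le_between in H.
    pose proof (pow2_ge_0 (- INR K + (INR j + / 2) / x)). lra. }
  set (lo := sqrt (Rmax 0 (a - s))). set (hi := sqrt (a + s)).
  assert (Hm : 0 <= Rmax 0 (a - s) <= a + s).
  { split; [apply Rmax_l|]. apply Rmax_lub; lra. }
  assert (Hlo : 0 <= lo) by apply sqrt_pos.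
  assert (Hhi : lo <= hi <= lo + sqrt (2 * s)).
  { split; [apply sqrt_le_1_alt; lra|].
    eapply Rle_trans; [apply (sqrt_diff_le _ (Rmax 0 (a - s))); lra|].
    apply Rplus_le_compat_l, sqrt_le_1_alt. pose proof (Rmax_r 0 (a - s)). lra. }
  pose (ind := fun u v => fun j => if Rle_dec u (INR j) then if Rle_dec (INR j) v then 1 else 0 else 0).
  apply Rle_trans with (rsum m (fun j =>
     ind ((lo + INR K) * x - / 2) ((hi + INR K) * x - / 2) j
   + ind ((- hi + INR K) * x - / 2) ((- lo + INR K) * x - / 2) j)).
  - apply rsum_le. intros j _.
    set (y := - INR K + (INR j + / 2) / x).
    assert (Hj : INR j = (y + INR K) * x - / 2) by (unfold y; field; lra).
    assert (Hind : forall u v, 0 <= ind u v j).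
    { intros. unfold ind. repeat destruct Rle_dec; lra. }
    destruct Rle_dec as [H|H]; [|pose proof (Hind ((lo + INR K) * x - / 2) ((hi + INR K) * x - / 2));
      pose proof (Hind ((- hi + INR K) * x - / 2) ((- lo + INR K) * x - / 2)); lra].
    apply Rabs_le_between in H.
    assert (Hy : lo <= Rabs y <= hi).
    { rewrite <- sqrt_Rsqr_abs. unfold Rsqr, lo, hi.
      split; apply sqrt_le_1_alt; [apply Rmax_lub|]; nra. }
    destruct (Rle_dec 0 y) as [Hy0|Hy0].
    + rewrite Rabs_right in Hy by lra.
      replace (ind ((lo + INR K) * x - / 2) ((hi + INR K) * x - / 2) j) with 1;
        [specialize (Hind ((- hi + INR K) * x - / 2) ((- lo + INR K) * x - / 2)); lra|].
      unfold ind. rewrite Hj. repeat destruct Rle_dec; nra.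
    + rewrite Rabs_left in Hy by lra.
      replace (ind ((- hi + INR K) * x - / 2) ((- lo + INR K) * x - / 2) j) with 1;
        [specialize (Hind ((lo + INR K) * x - / 2) ((hi + INR K) * x - / 2)); lra|].
      unfold ind. rewrite Hj. repeat destruct Rle_dec; nra.
  - rewrite rsum_plus.
    pose proof (count_le m ((lo + INR K) * x - / 2) ((hi + INR K) * x - / 2) ltac:(nra)).
    pose proof (count_le m ((- hi + INR K) * x - / 2) ((- lo + INR K) * x - / 2) ltac:(nra)).
    fold ind in H, H0. unfold ind. nra.
Qed.

Definition upd (d : nat) (v : nat -> R) (y : R) (i : nat) : R :=
  if Nat.eqb i d then y else v i.

Lemma gridsum_shell_le (d K k : nat) (Q : (nat -> R) -> R) (R0 s : R) :
  (0 < K)%nat -> 0 <= s ->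
  (forall v y y', Q (upd d v y) - y ^ 2 = Q (upd d v y') - y' ^ 2) ->
  gridsum (S d) (2 * S k * K)
    (fun p => if Rle_dec (Rabs (Q (gpt K k p) - R0)) s then 1 else 0)
  <= INR (2 * S k * K) ^ d * (2 * (sqrt (2 * s) * INR (S k)) + 2).
Proof.
  intros HK Hs HQ. rewrite gridsum_S, <- gridsum_rsum, <- gridsum_const.
  apply gridsum_le; [lia|]. intros p _.
  pose (v := gpt K k p).
  apply Rle_trans with (2 := coord_shell_le K k (2 * S k * K) (R0 - Q (upd d v 0)) s Hs).
  apply rsum_le. intros j _.
  set (y := - INR K + (INR j + / 2) / INR (S k)).
  replace (gpt K k (fun i => if Nat.eqb i d then j else p i)) with (upd d v y).
  - replace (y ^ 2 - (R0 - Q (upd d v 0))) with (Q (upd d v y) - R0); [lra|].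
    specialize (HQ v y 0). lra.
  - apply functional_extensionality. intros i. unfold upd, v, y, gpt.
    destruct (Nat.eqb i d); reflexivity.
Qed.

(** With mesh w, cells away from the sphere contribute O(w). The shell has thickness O(w) in [Q]
    but, as a line can graze the sphere, it may meet that line in length O(sqrt w); this fixes the
    rate. The bound does not depend on how much finer the second grid is. *)
Lemma rsm_refine_bound (d K : nat) (R0 : R) (Q E : (nat -> R) -> R) :
  (0 < K)%nat -> tame (INR K) Q -> tame (INR K) E ->
  (forall v y y', Q (upd d v y) - y ^ 2 = Q (upd d v y') - y' ^ 2) ->
  exists C, 0 <= C /\ forall k l k', S k' = (S k * S l)%nat ->
    Rabs (rsm (S d) K (cut_exp R0 Q E) k - rsm (S d) K (cut_exp R0 Q E) k')
    <= C * sqrt (/ INR (S k)).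
Proof.
  intros HK HQt HEt HQ.
  destruct (cut_exp_osc _ R0 _ _ HQt HEt) as (L & HL & Hosc).
  set (g := cut_exp R0 Q E) in *.
  assert (HKR : 0 < INR K) by (apply lt_0_INR; exact HK).
  set (T := (2 * INR K) ^ d). assert (HT : 0 <= T) by (unfold T; apply pow_le; lra).
  exists (T * (2 * INR K) * L + L * (T * (2 * sqrt (2 * L) + 2))).
  pose proof (sqrt_pos (2 * L)) as HsL.
  split.
  { assert (0 <= T * (2 * INR K)) by (apply Rmult_le_pos; lra).
    assert (0 <= T * (2 * sqrt (2 * L) + 2)) by (apply Rmult_le_pos; lra). nra. }
  intros k l k' Hk'.
  set (x := INR (S k)). assert (Hx : 1 <= x) by (apply (le_INR 1); lia).
  set (w := / x). assert (Hw : 0 < w <= 1).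
  { split; [apply Rinv_0_lt_compat; lra|]. unfold w. rewrite <- Rinv_1. apply Rinv_le_contravar; lra. }
  assert (Hwx : w * x = 1) by (unfold w; field; lra).
  set (y := INR (S l)). assert (Hy : 0 < y) by apply INR_S_pos.
  set (m := (2 * S k * K)%nat). assert (Hm : (0 < m)%nat) by (unfold m; lia).
  assert (HmR : w * INR m = 2 * INR K).
  { unfold m. rewrite !mult_INR. fold x. change (INR 2) with 2. nra. }
  assert (Hk'x : / INR (S k') = w * / y).
  { rewrite Hk', mult_INR. fold x y. unfold w. field. lra. }
  set (chi := fun p => if Rle_dec (Rabs (Q (gpt K k p) - R0)) (L * w) then 1 else 0).
  (* Both sums are written on the fine grid, the coarse value being repeated on the y^(S d) subcells
     of its cell. *)
  assert (Hdiff : rsm (S d) K g k - rsm (S d) K g k' =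
    (w * / y) ^ S d * gridsum (S d) m (fun p => gridsum (S d) (S l) (fun q =>
       g (gpt K k p) + -1 * g (gpt K k' (fun i => (p i * S l + q i)%nat))))).
  { unfold rsm. rewrite Hk'x. fold x. fold w.
    replace (2 * S k' * K)%nat with (m * S l)%nat by (unfold m; rewrite Hk'; ring).
    rewrite (gridsum_refine (S d) m (S l)). fold m.
    rewrite (gridsum_ext (S d) m (fun p => gridsum (S d) (S l) (fun q =>
       g (gpt K k p) + -1 * g (gpt K k' (fun i => (p i * S l + q i)%nat))))
      (fun p => y ^ S d * g (gpt K k p) + -1 * gridsum (S d) (S l) (fun q =>
        g (gpt K k' (fun i => (p i * S l + q i)%nat))))); auto.
    - rewrite gridsum_plus, !gridsum_scal, Rmult_plus_distr_l, <- Rmult_assoc, <- Rpow_mult_distr.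
      replace (w * / y * y) with w by (field; lra). ring.
    - intros p _. rewrite gridsum_plus, gridsum_const, gridsum_scal. reflexivity. }
  rewrite Hdiff, Rabs_mult.
  assert (Hwy : 0 < w * / y) by (apply Rmult_lt_0_compat; [lra|apply Rinv_0_lt_compat; lra]).
  rewrite (Rabs_right ((w * / y) ^ S d)) by (apply Rle_ge, pow_le; lra).
  apply Rle_trans with ((w * / y) ^ S d * gridsum (S d) m (fun p => gridsum (S d) (S l) (fun _ =>
      L * w + L * chi p))).
  { apply Rmult_le_compat_l; [apply pow_le; lra|].
    eapply Rle_trans; [apply gridsum_abs; auto|].
    apply gridsum_le; auto. intros p Hp.
    eapply Rle_trans; [apply gridsum_abs; lia|].
    apply gridsum_le; [lia|]. intros q Hq.
    replace (g (gpt K k p) + -1 * g (gpt K k' (fun i => (p i * S l + q i)%nat)))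
      with (g (gpt K k p) - g (gpt K k' (fun i => (p i * S l + q i)%nat))) by lra.
    apply Hosc.
    - apply gpt_inbox. exact Hp.
    - apply gpt_inbox. intros i. rewrite Hk'.
      replace (2 * (S k * S l) * K)%nat with (m * S l)%nat by (unfold m; ring).
      specialize (Hp i). specialize (Hq i). fold m in Hp. nia.
    - intros i. apply gpt_refine; auto. }
  rewrite (gridsum_ext (S d) m _ (fun p => y ^ S d * (L * w + L * chi p)));
    [|exact Hm|intros p _; rewrite gridsum_const; reflexivity].
  rewrite gridsum_scal, <- Rmult_assoc, <- Rpow_mult_distr.
  replace (w * / y * y) with w by (field; lra).
  rewrite gridsum_plus, gridsum_const, gridsum_scal.
  pose proof (gridsum_shell_le d K k Q R0 (L * w) HK ltac:(apply Rmult_le_pos; lra) HQ) as Hsh.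
  fold m chi in Hsh. fold x in Hsh.
  assert (Hsw : w <= sqrt w).
  { rewrite <- (sqrt_Rsqr w) at 1 by lra. apply sqrt_le_1_alt. unfold Rsqr. nra. }
  assert (Hs2 : sqrt (2 * (L * w)) = sqrt (2 * L) * sqrt w).
  { rewrite <- sqrt_mult by lra. f_equal. ring. }
  assert (HwT : w ^ d * INR m ^ d = T) by (rewrite <- Rpow_mult_distr, HmR; reflexivity).
  assert (H1 : w ^ S d * (INR m ^ S d * (L * w)) = T * (2 * INR K) * L * w).
  { simpl. rewrite <- HwT, <- HmR. ring. }
  assert (H2 : w ^ S d * (L * gridsum (S d) m chi) <= L * (T * (2 * sqrt (2 * L) * sqrt w + 2 * w))).
  { apply Rle_trans with (w ^ S d * (L * (INR m ^ d * (2 * (sqrt (2 * (L * w)) * x) + 2)))).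
    - apply Rmult_le_compat_l; [apply pow_le; lra|]. apply Rmult_le_compat_l; assumption.
    - right. rewrite Hs2, <- HwT. simpl.
      replace (w * w ^ d * (L * (INR m ^ d * (2 * (sqrt (2 * L) * sqrt w * x) + 2))))
        with (L * (w ^ d * INR m ^ d * (2 * sqrt (2 * L) * sqrt w * (w * x) + 2 * w))) by ring.
      rewrite Hwx. ring. }
  rewrite Rmult_plus_distr_l, H1.
  eapply Rle_trans; [apply Rplus_le_compat_l, H2|].
  rewrite Rmult_plus_distr_r. apply Rplus_le_compat.
  - apply Rmult_le_compat_l; [|exact Hsw].
    apply Rmult_le_pos; [apply Rmult_le_pos; lra|lra].
  - replace (L * (T * (2 * sqrt (2 * L) + 2)) * sqrt w)
      with (L * (T * ((2 * sqrt (2 * L) + 2) * sqrt w))) by ring.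
    apply Rmult_le_compat_l; [lra|]. apply Rmult_le_compat_l; [lra|]. lra.
Qed.

Lemma Un_cv_inv_S : Un_cv (fun k => sqrt (/ INR (S k))) 0.
Proof.
  intros e He. destruct (archimed_cor1 (e ^ 2)) as (N & HN & HN0); [nra|].
  exists N. intros k Hk. unfold R_dist. rewrite Rminus_0_r, Rabs_right by (apply Rle_ge, sqrt_pos).
  rewrite <- (sqrt_pow2 e) by lra. apply sqrt_lt_1_alt. split.
  - left. apply Rinv_0_lt_compat, INR_S_pos.
  - eapply Rle_lt_trans; [|exact HN]. apply Rinv_le_contravar; [apply lt_0_INR; lia|].
    apply le_INR. lia.
Qed.

Lemma rsm_converges (d K : nat) (R0 : R) (Q E : (nat -> R) -> R) :
  (0 < K)%nat -> tame (INR K) Q -> tame (INR K) E ->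
  (forall v y y', Q (upd d v y) - y ^ 2 = Q (upd d v y') - y' ^ 2) ->
  exists z, Un_cv (rsm (S d) K (cut_exp R0 Q E)) z.
Proof.
  intros HK HQt HEt HQ.
  destruct (rsm_refine_bound d K R0 Q E HK HQt HEt HQ) as (C & HC & H).
  set (u := rsm (S d) K (cut_exp R0 Q E)) in *.
  destruct (Rcomplete.R_complete u) as [z Hz]; [|exists z; exact Hz].
  intros e He.
  destruct (Un_cv_inv_S (e / (2 * (C + 1)))) as (N & HN).
  { apply Rdiv_lt_0_compat; lra. }
  assert (Hs : forall k, (k >= N)%nat -> C * sqrt (/ INR (S k)) < e / 2).
  { intros k Hk. specialize (HN k Hk). unfold R_dist in HN.
    pose proof (sqrt_pos (/ INR (S k))).
    rewrite Rminus_0_r, Rabs_right in HN by lra.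
    apply Rlt_div_r in HN; [|lra]. nra. }
  exists N. intros k l Hk Hl. unfold R_dist.
  (* Two grids need not be nested; both are compared with their common refinement, of [S k * S l]
     cells per unit length. *)
  set (k' := (S k * S l - 1)%nat).
  assert (Hk' : S k' = (S k * S l)%nat) by (unfold k'; lia).
  pose proof (H k l k' Hk') as H1. pose proof (H l k k' ltac:(lia)) as H2.
  pose proof (Hs k Hk). pose proof (Hs l Hl).
  replace (u k - u l) with ((u k - u k') - (u l - u k')) by lra.
  eapply Rle_lt_trans; [apply Rabs_triang|]. rewrite Rabs_Ropp. lra.
Qed.

(** * Convergence for the partition function *)

Lemma Nmass_sum (n : nat) (c : nat -> R) : Nmass n c = rsum (2 * n) (fun i => c i ^ 2).
Proof.
  replace (2 * n)%nat with (n + n)%nat by lia.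
  unfold Nmass, abs2. rewrite rsum_plus, rsum_add. reflexivity.
Qed.

Lemma boxK_bounds (n : nat) (B : R) :
  0 < B -> B * INR n + 1 <= INR (boxK n B) <= B * INR n + 2.
Proof.
  intros HB. unfold boxK. rewrite S_INR, (INR_IZR_INZ (Z.to_nat (up (B * INR n)))).
  assert (H0 : 0 <= B * INR n) by (apply Rmult_le_pos; [lra|apply pos_INR]).
  pose proof (archimed (B * INR n)) as [H1 H2].
  assert (0 < up (B * INR n))%Z by (apply lt_IZR; lra).
  rewrite Z2Nat.id by lia. lra.
Qed.

Lemma riemann_sum_rsm (n : nat) (adj : nat -> nat -> bool) (h beta B : R) (k : nat) :
  riemann_sum n adj h beta B k = rsm (2 * n) (boxK n B) (integrand n adj h beta B) k.
Proof. reflexivity. Qed.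

Lemma Hamil_tame (n : nat) (adj : nat -> nat -> bool) (h K : R) :
  0 <= K -> tame K (Hamil n adj h).
Proof.
  intros HK. unfold Hamil. apply tame_minus.
  - apply tame_scal, tame_rsum. intros x. apply tame_rsum. intros y.
    destruct (_ && _)%bool; [|apply tame_const].
    apply tame_mult; [|apply tame_const].
    apply tame_plus; apply tame_pow, tame_minus; apply tame_coord; assumption.
  - apply tame_scal, tame_rsum. intros x. apply tame_pow.
    unfold abs2. apply tame_plus; apply tame_pow, tame_coord; assumption.
Qed.

Lemma Zpart_limit (n : nat) (adj : nat -> nat -> bool) (h beta B : R) :
  (0 < n)%nat -> Un_cv (riemann_sum n adj h beta B) (Zpart n adj h beta B).
Proof.
  intros Hn. unfold Zpart. apply epsilon_spec.
  (* The shell estimate singles out the last coordinate, so the dimension must be a successor; here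
     n > 0 enters. *)
  set (K := boxK n B). set (d := (2 * n - 1)%nat).
  assert (Hd : (2 * n = S d)%nat) by (unfold d; lia).
  destruct (rsm_converges d K (B * INR n) (Nmass n) (fun v => - beta * Hamil n adj h v)) as (z & Hz).
  - unfold K, boxK. lia.
  - unfold Nmass, abs2. apply tame_rsum. intros x.
    apply tame_plus; apply tame_pow, tame_coord, pos_INR.
  - apply tame_scal, Hamil_tame, pos_INR.
  - intros v y y'. rewrite !Nmass_sum, Hd, !rsum_S. unfold upd. rewrite Nat.eqb_refl.
    rewrite (rsum_ext d _ (fun i => (if Nat.eqb i d then y' else v i) ^ 2)); [lra|].
    intros i Hi. destruct (Nat.eqb_spec i d); [lia|reflexivity].
  - exists z. rewrite <- Hd in Hz. exact Hz.
Qed.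

(** * Gaussian integrals *)

Definition gauss_int (x : R) : R := RInt (fun t => exp (- t ^ 2)) 0 x.

Lemma continuous_gauss (c t : R) : continuous (fun t => exp (- (c * t ^ 2))) t.
Proof.
  apply (ex_derive_continuous (fun t => exp (- (c * t ^ 2)))). auto_derive. auto.
Qed.

Lemma ex_RInt_gauss (c a b : R) : ex_RInt (fun t => exp (- (c * t ^ 2))) a b.
Proof.
  apply (ex_RInt_continuous (V := R_CompleteNormedModule)). intros. apply continuous_gauss.
Qed.

Lemma gauss_1 : (fun t => exp (- t ^ 2)) = (fun t => exp (- (1 * t ^ 2))).
Proof. apply functional_extensionality. intros. f_equal. ring. Qed.

Lemma is_derive_gauss_int (x : R) : is_derive gauss_int x (exp (- x ^ 2)).
Proof.
  unfold gauss_int. rewrite gauss_1.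
  replace (exp (- x ^ 2)) with ((fun t => exp (- (1 * t ^ 2))) x) by (f_equal; ring).
  apply (is_derive_RInt (fun t => exp (- (1 * t ^ 2))) _ 0).
  - exists (mkposreal 1 Rlt_0_1). intros y _. apply (RInt_correct (V := R_CompleteNormedModule)), ex_RInt_gauss.
  - apply continuous_gauss.
Qed.

Lemma gauss_int_scale (s x : R) :
  s * RInt (fun t => exp (- (s ^ 2 * t ^ 2))) 0 x = gauss_int (s * x).
Proof.
  unfold gauss_int.
  pose proof (RInt_comp_lin (V := R_CompleteNormedModule) (fun t => exp (- t ^ 2)) s 0 0 x) as H.
  rewrite Rmult_0_r, !Rplus_0_r in H. rewrite <- H.
  - rewrite <- (RInt_scal (V := R_CompleteNormedModule)) by apply ex_RInt_gauss.
    apply RInt_ext. intros t _. unfold scal; simpl. unfold mult; simpl.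
    rewrite Rplus_0_r. f_equal. f_equal. ring.
  - rewrite gauss_1. apply ex_RInt_gauss.
Qed.

Lemma gauss_int_opp (x : R) : gauss_int (- x) = - gauss_int x.
Proof.
  replace (- x) with (-1 * x) by ring. rewrite <- gauss_int_scale.
  unfold gauss_int. rewrite (RInt_ext _ (fun t => exp (- t ^ 2))); [ring|].
  intros t _. f_equal. ring.
Qed.

(** Kernel of the classical parametric proof of the Gaussian integral: [gauss_int x ^ 2] plus the
    integral of this kernel over [0, 1] has derivative 0 in x, and at x = 0 it equals arctan 1 = pi
    / 4. *)
Definition gauss_aux (x t : R) : R := exp (- (x ^ 2 * (1 + t ^ 2))) / (1 + t ^ 2).

Lemma one_plus_sq_pos (t : R) : 0 < 1 + t ^ 2.
Proof. pose proof (pow2_ge_0 t). lra. Qed.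

Lemma is_derive_gauss_aux (x t : R) :
  is_derive (fun u => gauss_aux u t) x (-2 * x * exp (- (x ^ 2 * (1 + t ^ 2)))).
Proof.
  unfold gauss_aux. pose proof (one_plus_sq_pos t).
  auto_derive; [lra|]. simpl. field. simpl in *. lra.
Qed.

Lemma ex_RInt_gauss_aux (x a b : R) : ex_RInt (gauss_aux x) a b.
Proof.
  apply (ex_RInt_continuous (V := R_CompleteNormedModule)). intros t _.
  apply (ex_derive_continuous (gauss_aux x)). unfold gauss_aux. auto_derive.
  pose proof (one_plus_sq_pos t). simpl in *. lra.
Qed.

(** Differentiation under the integral sign cancels the denominator; the substitution s = x t then
    turns the remaining integral into [gauss_int x]. *)
Lemma is_derive_RInt_gauss_aux (x : R) :
  is_derive (fun u => RInt (gauss_aux u) 0 1) x (-2 * exp (- x ^ 2) * gauss_int x).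
Proof.
  replace (-2 * exp (- x ^ 2) * gauss_int x)
    with (RInt (fun t => Derive (fun u => gauss_aux u t) x) 0 1).
  - apply (is_derive_RInt_param gauss_aux 0 1 x).
    + exists (mkposreal 1 Rlt_0_1). intros y _ t _. eexists. apply is_derive_gauss_aux.
    + intros t _.
      apply continuity_2d_pt_ext with (fun u v => -2 * u * exp (- (u * u * (1 + v * v)))).
      { intros u v. symmetry. etransitivity; [apply is_derive_unique, is_derive_gauss_aux|].
        do 2 f_equal. ring. }
      apply continuity_2d_pt_mult.
      * apply continuity_2d_pt_mult; [apply continuity_2d_pt_const|apply continuity_2d_pt_id1].
      * apply (continuity_1d_2d_pt_comp exp); [apply derivable_continuous_pt, derivable_pt_exp|].
        apply continuity_2d_pt_opp, continuity_2d_pt_mult.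
        -- apply continuity_2d_pt_mult; apply continuity_2d_pt_id1.
        -- apply continuity_2d_pt_plus; [apply continuity_2d_pt_const|].
           apply continuity_2d_pt_mult; apply continuity_2d_pt_id2.
    + exists (mkposreal 1 Rlt_0_1). intros y _. apply (ex_RInt_gauss_aux y).
  - rewrite (RInt_ext _ (fun t => scal (-2 * x * exp (- x ^ 2)) (exp (- (x ^ 2 * t ^ 2))))).
    + rewrite (RInt_scal (V := R_CompleteNormedModule)) by apply ex_RInt_gauss.
      pose proof (gauss_int_scale x 1) as H. rewrite Rmult_1_r in H. rewrite <- H.
      unfold scal; simpl. unfold mult; simpl. ring.
    + intros t _. etransitivity; [apply is_derive_unique, is_derive_gauss_aux|].
      unfold scal; simpl. unfold mult; simpl.
      rewrite !Rmult_assoc, <- exp_plus. do 3 f_equal. ring.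
Qed.

Lemma RInt_gauss_aux_0 : RInt (gauss_aux 0) 0 1 = PI / 4.
Proof.
  rewrite <- atan_1. replace (atan 1) with (atan 1 - atan 0) by (rewrite atan_0; ring).
  apply is_RInt_unique.
  apply (is_RInt_derive (V := R_CompleteNormedModule) atan (gauss_aux 0) 0 1).
  - intros t _. replace (gauss_aux 0 t) with (/ (1 + Rsqr t)); [apply is_derive_atan|].
    unfold gauss_aux. replace (- (0 ^ 2 * (1 + t ^ 2))) with 0 by ring.
    rewrite exp_0. unfold Rdiv, Rsqr. rewrite Rmult_1_l. f_equal. ring.
  - intros t _. apply (ex_derive_continuous (gauss_aux 0)). unfold gauss_aux. auto_derive.
    pose proof (one_plus_sq_pos t). simpl in *. lra.
Qed.

Lemma gauss_int_sq (x : R) : 0 <= x -> gauss_int x ^ 2 = PI / 4 - RInt (gauss_aux x) 0 1.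
Proof.
  intros Hx. set (F := fun x => gauss_int x * gauss_int x + RInt (gauss_aux x) 0 1).
  assert (HF : F x = F 0).
  { destruct Hx as [Hx| <-]; [|reflexivity]. symmetry. apply eq_is_derive; [|exact Hx].
    intros t _. unfold F.
    replace (zero : R_NormedModule) with
      ((exp (- t ^ 2) * gauss_int t + gauss_int t * exp (- t ^ 2))
        + (-2 * exp (- t ^ 2) * gauss_int t)) by (unfold zero; simpl; ring).
    apply (is_derive_plus (fun t => gauss_int t * gauss_int t) (fun t => RInt (gauss_aux t) 0 1)).
    - apply (is_derive_mult gauss_int gauss_int t); try apply is_derive_gauss_int.
      intros; apply Rmult_comm.
    - apply is_derive_RInt_gauss_aux. }
  unfold F in HF. rewrite RInt_gauss_aux_0 in HF.
  assert (H0 : gauss_int 0 = 0).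
  { unfold gauss_int. rewrite (RInt_point (V := R_CompleteNormedModule)). reflexivity. }
  rewrite H0 in HF. simpl. lra.
Qed.

(** The kernel at x is at most exp (- x^2) times the kernel at 0. An explicit error is wanted
    because the integrals run over a finite box. *)
Lemma gauss_int_sq_bounds (x : R) :
  0 <= x -> PI / 4 * (1 - exp (- x ^ 2)) <= gauss_int x ^ 2 <= PI / 4.
Proof.
  intros Hx. rewrite gauss_int_sq by assumption.
  assert (H0 : 0 <= RInt (gauss_aux x) 0 1).
  { apply RInt_ge_0; [lra|apply ex_RInt_gauss_aux|]. intros t _. unfold gauss_aux.
    apply Rdiv_le_0_compat; [left; apply exp_pos|apply one_plus_sq_pos]. }
  assert (H1 : RInt (gauss_aux x) 0 1 <= RInt (fun t => scal (exp (- x ^ 2)) (gauss_aux 0 t)) 0 1).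
  { apply RInt_le; [lra|apply ex_RInt_gauss_aux| |].
    - apply (ex_RInt_scal (V := R_CompleteNormedModule)), ex_RInt_gauss_aux.
    - intros t _. unfold gauss_aux, scal; simpl. unfold mult; simpl.
      replace (- (0 * (0 * 1) * (1 + t * (t * 1)))) with 0 by ring. rewrite exp_0.
      unfold Rdiv. rewrite Rmult_1_l. pose proof (one_plus_sq_pos t) as Ht. simpl in Ht.
      apply Rmult_le_compat_r; [left; apply Rinv_0_lt_compat; exact Ht|].
      apply exp_le_compat. pose proof (pow2_ge_0 x). pose proof (pow2_ge_0 t). simpl in *. nra. }
  rewrite (RInt_scal (V := R_CompleteNormedModule)) in H1 by apply ex_RInt_gauss_aux.
  rewrite RInt_gauss_aux_0 in H1. unfold scal in H1; simpl in H1. unfold mult in H1; simpl in H1.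
  simpl. lra.
Qed.

Definition gauss_box (K : nat) (c : R) : R := RInt (fun t => exp (- (c * t ^ 2))) (- INR K) (INR K).

(** Rescaling by sqrt c. The square is the natural quantity: it is the weight of one site, which has
    two real coordinates. *)
Lemma gauss_box_sq_bounds (K : nat) (c : R) :
  0 < c -> PI / c * (1 - exp (- (c * INR K ^ 2))) <= gauss_box K c ^ 2 <= PI / c.
Proof.
  intros Hc. set (s := sqrt c). assert (Hs : 0 < s) by (apply sqrt_lt_R0; lra).
  assert (Hs2 : s ^ 2 = c) by (unfold s; rewrite pow2_sqrt; lra).
  assert (H : s * gauss_box K c = 2 * gauss_int (s * INR K)).
  { unfold gauss_box.
    rewrite <- (RInt_Chasles (V := R_CompleteNormedModule) _ _ 0) by apply ex_RInt_gauss.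
    rewrite <- (opp_RInt_swap (V := R_CompleteNormedModule)) by apply ex_RInt_gauss.
    rewrite <- Hs2. unfold plus, opp; simpl. unfold opp; simpl.
    rewrite Rmult_plus_distr_l, Ropp_mult_distr_r_reverse.
    change (s * (s * 1)) with (s ^ 2).
    replace (fun t => exp (- (s ^ 2 * (t * (t * 1))))) with (fun t => exp (- (s ^ 2 * t ^ 2)))
      by (apply functional_extensionality; intros; reflexivity).
    rewrite !gauss_int_scale, Ropp_mult_distr_r_reverse, gauss_int_opp. ring. }
  assert (Hx : 0 <= s * INR K) by (apply Rmult_le_pos; [lra|apply pos_INR]).
  pose proof (gauss_int_sq_bounds _ Hx) as [H1 H2].
  replace (gauss_box K c ^ 2) with (4 * gauss_int (s * INR K) ^ 2 / c).
  - replace ((s * INR K) ^ 2) with (c * INR K ^ 2) in H1 by (rewrite <- Hs2; ring).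
    unfold Rdiv in *. assert (0 < / c) by (apply Rinv_0_lt_compat; lra). split; nra.
  - replace (gauss_int (s * INR K)) with (s * gauss_box K c / 2) by lra.
    set (g := gauss_box K c). rewrite <- Hs2. field. lra.
Qed.

Lemma gauss_box_nonneg (K : nat) (c : R) : 0 <= gauss_box K c.
Proof.
  apply RInt_ge_0; [pose proof (pos_INR K); lra|apply ex_RInt_gauss|].
  intros; left; apply exp_pos.
Qed.

(** * Midpoint sums in one dimension *)

Definition msum (K k : nat) (f : R -> R) : R :=
  / INR (S k) * rsum (2 * S k * K) (fun j => f (- INR K + (INR j + / 2) / INR (S k))).

Lemma msum_RInt_le (K k : nat) (f : R -> R) (L : R) :
  (forall t, continuous f t) ->
  (forall s t, Rabs s <= INR K -> Rabs t <= INR K -> Rabs (f s - f t) <= L * Rabs (s - t)) ->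
  0 <= L ->
  Rabs (msum K k f - RInt f (- INR K) (INR K)) <= 2 * INR K * L * / INR (S k).
Proof.
  intros Hc HL HL0. unfold msum.
  assert (Hend' : INR (2 * S k * K) = 2 * INR (S k) * INR K) by (rewrite !mult_INR; reflexivity).
  assert (Hx : 0 < INR (S k)) by apply INR_S_pos.
  set (x := INR (S k)) in *. set (w := / x).
  assert (Hw : 0 < w) by (apply Rinv_0_lt_compat; lra).
  assert (Hex : forall a b, ex_RInt f a b).
  { intros. apply (ex_RInt_continuous (V := R_CompleteNormedModule)). auto. }
  assert (Hend : w * INR (2 * S k * K) = 2 * INR K).
  { rewrite Hend'. unfold w. field. lra. }
  (* Induction on the number m of cells, against the integral up to the right end of the last one;
     each cell of width w costs at most L w^2. *)
  assert (H : forall m, (m <= 2 * S k * K)%nat ->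
    Rabs (w * rsum m (fun j => f (- INR K + (INR j + / 2) / x))
          - RInt f (- INR K) (- INR K + w * INR m)) <= w * INR m * (L * w)).
  { induction m as [|m IH]; intros Hm.
    - rewrite rsum_0. simpl. rewrite !Rmult_0_r, Rplus_0_r, Rmult_0_l.
      rewrite (RInt_point (V := R_CompleteNormedModule)). unfold zero; simpl.
      rewrite Rminus_0_r, Rabs_R0. lra.
    - rewrite rsum_S, (S_INR m). specialize (IH ltac:(lia)).
      assert (Hm1 : w * (INR m + 1) <= 2 * INR K).
      { rewrite <- Hend, <- S_INR. apply Rmult_le_compat_l; [lra|]. apply le_INR. lia. }
      set (a := - INR K + w * INR m) in *.
      assert (Ha : - INR K <= a).
      { unfold a. pose proof (Rmult_le_pos w (INR m) ltac:(lra) (pos_INR m)). lra. }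
      replace (- INR K + w * (INR m + 1)) with (a + w) by (unfold a; ring).
      rewrite <- (RInt_Chasles (V := R_CompleteNormedModule) f (- INR K) a) by auto.
      unfold plus; simpl.
      set (v := - INR K + (INR m + / 2) / x).
      assert (Hv : v = a + w / 2) by (unfold v, a, w; field; lra).
      assert (Hcell : Rabs (w * f v - RInt f a (a + w)) <= w * (L * w)).
      { replace (w * f v - RInt f a (a + w)) with (RInt (fun t => minus (f v) (f t)) a (a + w)).
        - replace (w * (L * w)) with ((a + w - a) * (L * w)) by ring.
          apply abs_RInt_le_const; [lra| |].
          + apply (ex_RInt_minus (V := R_CompleteNormedModule)); [apply ex_RInt_const|auto].
          + intros t Ht. unfold minus, plus, opp; simpl.
            eapply Rle_trans; [apply HL; apply Rabs_le; unfold a in *; lra|].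
            apply Rmult_le_compat_l; [lra|]. apply Rabs_le. lra.
        - rewrite (RInt_minus (V := R_CompleteNormedModule)); [|apply ex_RInt_const|auto].
          rewrite RInt_const. unfold scal, minus, plus, opp; simpl. unfold mult; simpl. ring. }
      replace (w * (rsum m (fun j => f (- INR K + (INR j + / 2) / x)) + f v) -
        (RInt f (- INR K) a + RInt f a (a + w))) with
        ((w * rsum m (fun j => f (- INR K + (INR j + / 2) / x)) - RInt f (- INR K) a)
          + (w * f v - RInt f a (a + w))) by ring.
      eapply Rle_trans; [apply Rabs_triang|]. lra. }
  specialize (H (2 * S k * K)%nat (Nat.le_refl _)). rewrite Hend in H.
  replace (- INR K + 2 * INR K) with (INR K) in H by ring.
  lra.
Qed.

Lemma Un_cv_const (a : R) : Un_cv (fun _ => a) a.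
Proof. intros e He. exists O. intros. unfold R_dist. rewrite Rminus_diag, Rabs_R0. lra. Qed.

Lemma Un_cv_msum_gauss (K : nat) (c : R) :
  0 <= c -> Un_cv (fun k => msum K k (fun t => exp (- (c * t ^ 2)))) (gauss_box K c).
Proof.
  intros Hc. set (L := c * (2 * INR K)).
  assert (HL0 : 0 <= L).
  { apply Rmult_le_pos; [lra|]. pose proof (pos_INR K). lra. }
  assert (HL : forall s t, Rabs s <= INR K -> Rabs t <= INR K ->
    Rabs (exp (- (c * s ^ 2)) - exp (- (c * t ^ 2))) <= L * Rabs (s - t)).
  { intros s t Hs Ht. eapply Rle_trans; [apply (exp_lipschitz _ _ 0)|].
    - pose proof (pow2_ge_0 s). nra.
    - pose proof (pow2_ge_0 t). nra.
    - rewrite exp_0, Rmult_1_l.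
      replace (- (c * s ^ 2) - - (c * t ^ 2)) with (- (c * (s + t) * (s - t))) by ring.
      rewrite Rabs_Ropp, Rabs_mult, Rabs_mult, (Rabs_right c) by lra.
      apply Rmult_le_compat_r; [apply Rabs_pos|]. unfold L.
      apply Rmult_le_compat_l; [lra|]. eapply Rle_trans; [apply Rabs_triang|]. lra. }
  set (M := 2 * INR K * L). assert (HM : 0 <= M).
  { apply Rmult_le_pos; [pose proof (pos_INR K); lra|lra]. }
  intros e He. destruct (archimed_cor1 (e / (M + 1))) as (N & HN & HN0).
  { apply Rdiv_lt_0_compat; lra. }
  exists N. intros k Hk. unfold R_dist.
  eapply Rle_lt_trans; [apply (msum_RInt_le K k _ L); auto; intros; apply continuous_gauss|].
  fold M. assert (H : / INR (S k) < e / (M + 1)).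
  { eapply Rle_lt_trans; [|exact HN]. apply Rinv_le_contravar; [apply lt_0_INR; lia|].
    apply le_INR. lia. }
  apply Rlt_div_r in H; [|lra].
  assert (0 < / INR (S k)) by (apply Rinv_0_lt_compat, INR_S_pos). nra.
Qed.

Lemma Un_cv_pow (u : nat -> R) (l : R) (m : nat) :
  Un_cv u l -> Un_cv (fun k => u k ^ m) (l ^ m).
Proof.
  intros H. induction m as [|m IH]; [apply (Un_cv_const 1)|]. simpl. apply CV_mult; assumption.
Qed.

Lemma Un_cv_rsum (m : nat) (u : nat -> nat -> R) (l : nat -> R) :
  (forall i, (i < m)%nat -> Un_cv (fun k => u k i) (l i)) ->
  Un_cv (fun k => rsum m (u k)) (rsum m l).
Proof.
  induction m as [|m IH]; intros H; [apply (Un_cv_const 0)|].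
  rewrite rsum_S. intros e He.
  destruct (CV_plus _ _ _ _ (IH ltac:(intros; apply H; lia)) (H m ltac:(lia)) e He) as (N & HN).
  exists N. intros k Hk. rewrite rsum_S. apply HN, Hk.
Qed.

Lemma Un_cv_le_eventually (u v : nat -> R) (a b : R) (N : nat) :
  (forall k, (k >= N)%nat -> u k <= v k) -> Un_cv u a -> Un_cv v b -> a <= b.
Proof.
  intros H Hu Hv. destruct (Rle_dec a b) as [|Hab]; [assumption|exfalso].
  destruct (Hu ((a - b) / 2) ltac:(lra)) as (N1 & H1).
  destruct (Hv ((a - b) / 2) ltac:(lra)) as (N2 & H2).
  set (k := (N + N1 + N2)%nat).
  specialize (H k ltac:(lia)). specialize (H1 k ltac:(lia)). specialize (H2 k ltac:(lia)).
  unfold R_dist in *. apply Rabs_def2 in H1. apply Rabs_def2 in H2. lra.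
Qed.

(** * The variational problem and the energy *)

Definition phi (t a : R) : R := t * a ^ 2 + ln (1 - a).

(* The critical points of [phi t] are [crit t] (local maximum) and [1 - crit t] (local minimum). *)
Definition crit (t : R) : R := 1 / 2 + 1 / 2 * sqrt (1 - 2 / t).

(** The equation is the vanishing of the derivative 2 t a - 1 / (1 - a) of [phi t], multiplied by 1
    - a. *)
Lemma crit_spec (t : R) :
  2 <= t -> 1 / 2 <= crit t < 1 /\ 2 * t * crit t * (1 - crit t) = 1.
Proof.
  intros Ht. unfold crit. set (s := sqrt (1 - 2 / t)).
  assert (H2 : 0 < 2 / t <= 1).
  { split; [apply Rdiv_lt_0_compat; lra|apply Rle_div_l; lra]. }
  assert (Hs0 : 0 <= s) by apply sqrt_pos.
  assert (Hs2 : s * s = 1 - 2 / t) by (apply sqrt_sqrt; lra).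
  assert (Hs1 : s < 1) by nra.
  split; [lra|].
  replace (2 * t * (1 / 2 + 1 / 2 * s) * (1 - (1 / 2 + 1 / 2 * s))) with (t / 2 * (1 - s * s)) by field.
  rewrite Hs2. field. lra.
Qed.

(** The critical equation turns [t * crit t ^ 2] into [t * crit t - 1 / 2], and [1 - crit t] is the
    argument of the logarithm in [mfun]. *)
Lemma mfun_phi_crit (t : R) : 2 <= t -> mfun t = phi t (crit t).
Proof.
  intros Ht. destruct (crit_spec t Ht) as [_ H].
  assert (H' : t * crit t ^ 2 = t * crit t - 1 / 2) by (simpl; nra).
  unfold phi. rewrite H'. unfold mfun, crit. set (s := sqrt (1 - 2 / t)).
  replace (1 - (1 / 2 + 1 / 2 * s)) with (1 / 2 - 1 / 2 * s) by field. field.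
Qed.

Lemma phi_diff (t a b : R) :
  a < 1 -> b < 1 ->
  exists c, Rmin a b <= c <= Rmax a b /\
    phi t b - phi t a = (2 * t * c * (1 - c) - 1) / (1 - c) * (b - a).
Proof.
  intros Ha Hb.
  destruct (MVT_gen (phi t) a b (fun c => (2 * t * c * (1 - c) - 1) / (1 - c))) as (c & Hc & H).
  - intros x [_ Hx]. assert (x < 1) by (revert Hx; unfold Rmax; destruct Rle_dec; lra).
    unfold phi. auto_derive; [lra|]. field. lra.
  - intros x [_ Hx]. assert (x < 1) by (revert Hx; unfold Rmax; destruct Rle_dec; lra).
    apply continuity_pt_filterlim, (ex_derive_continuous (phi t)).
    unfold phi. auto_derive. lra.
  - exists c. split; assumption.
Qed.

(** The numerator of the derivative factors as 2 t (c - (1 - crit t)) (crit t - c): beyond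
    [1 - crit t] the function rises up to [crit t] and falls afterwards. *)
Lemma phi_le_mfun (t a : R) : 2 <= t -> 1 - crit t <= a < 1 -> phi t a <= mfun t.
Proof.
  intros Ht Ha. rewrite mfun_phi_crit by assumption.
  destruct (crit_spec t Ht) as [Hc1 Hc2].
  destruct (phi_diff t a (crit t)) as (c & Hc & H); [lra|lra|].
  cut (0 <= (2 * t * c * (1 - c) - 1) / (1 - c) * (crit t - a)); [lra|].
  replace (2 * t * c * (1 - c) - 1) with (2 * t * ((c - (1 - crit t)) * (crit t - c))) by lra.
  assert (Hc3 : 0 < / (1 - c)).
  { apply Rinv_0_lt_compat. revert Hc. unfold Rmin, Rmax. destruct Rle_dec; lra. }
  unfold Rdiv.
  replace (2 * t * ((c - (1 - crit t)) * (crit t - c)) * / (1 - c) * (crit t - a))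
    with (2 * t * (c - (1 - crit t)) * / (1 - c) * ((crit t - c) * (crit t - a))) by ring.
  assert (Hcc : 0 <= (c - (1 - crit t)) /\ 0 <= (crit t - c) * (crit t - a)).
  { revert Hc. unfold Rmin, Rmax. destruct Rle_dec; intros; split; nra. }
  apply Rmult_le_pos; [|tauto]. apply Rmult_le_pos; [apply Rmult_le_pos; lra|lra].
Qed.

(** To the left of [1 - crit t] the function decreases from its value 0 at a = 0, so only the
    endpoint and the local maximum compete. *)
Lemma phi_le_max (t a : R) : 2 <= t -> 0 <= a < 1 -> phi t a <= Rmax 0 (mfun t).
Proof.
  intros Ht Ha. destruct (Rle_dec (1 - crit t) a) as [Hca|Hca].
  { eapply Rle_trans; [apply phi_le_mfun; lra|apply Rmax_r]. }
  eapply Rle_trans; [|apply Rmax_l].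
  destruct (crit_spec t Ht) as [Hc1 Hc2].
  destruct (phi_diff t 0 a) as (c & Hc & H); [lra|lra|].
  rewrite Rmin_left, Rmax_right in Hc by lra.
  assert (H0 : phi t 0 = 0) by (unfold phi; rewrite Rminus_0_r, ln_1; ring).
  rewrite H0, !Rminus_0_r in H. rewrite H.
  replace (2 * t * c * (1 - c) - 1) with (- (2 * t * ((1 - crit t - c) * (crit t - c)))) by lra.
  assert (Hc3 : 0 < / (1 - c)) by (apply Rinv_0_lt_compat; lra).
  assert (0 <= (1 - crit t - c) * (crit t - c)) by (apply Rmult_le_pos; lra).
  assert (0 <= 2 * t * ((1 - crit t - c) * (crit t - c))) by (apply Rmult_le_pos; lra).
  assert (0 <= / (1 - c) * a) by (apply Rmult_le_pos; lra).
  unfold Rdiv. nra.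
Qed.

Lemma ln_2_lt_1 : ln 2 < 1.
Proof. rewrite <- (ln_exp 1). apply ln_increasing; [lra|]. pose proof (exp_ineq1 1). lra. Qed.

(* With [t = 2 / (u (2 - u))], [mfun t] becomes [1/u - 1/2 + ln (u/2)]. *)
Lemma mfun_has_zero : exists t, 2 <= t /\ mfun t = 0.
Proof.
  set (g := fun u => - (1 / u - 1 / 2 + ln (u / 2))).
  (* u stands for 1 - sqrt (1 - 2 / t). The sign in [g] gives the order negative to positive: g
     (1/4) = 3 ln 2 - 7/2 and g 1 = ln 2 - 1/2. *)
  destruct (IVT_interv g (1 / 4) 1) as (u & Hu & Hg).
  - intros u Hu. apply continuity_pt_filterlim, (ex_derive_continuous g).
    unfold g. auto_derive. split; [lra|]. split; [lra|exact I].
  - lra.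
  - unfold g. replace (1 / 4 / 2) with (/ (2 ^ 3)) by field.
    rewrite ln_Rinv, ln_pow by lra. simpl. pose proof ln_2_lt_1. lra.
  - unfold g. replace (1 / 2) with (/ 2) by field. rewrite ln_Rinv by lra.
    pose proof ln_lt_2. lra.
  - exists (2 / (u * (2 - u))).
    assert (Huu : 0 < u * (2 - u) <= 1) by nra.
    split; [apply Rle_div_r; nra|].
    unfold mfun. replace (1 - 2 / (2 / (u * (2 - u)))) with ((1 - u) ^ 2) by (field; lra).
    rewrite sqrt_pow2 by lra.
    replace (1 / 2 - 1 / 2 * (1 - u)) with (u / 2) by field.
    unfold g in Hg. rewrite <- Ropp_0, <- Hg, Ropp_involutive. field. lra.
Qed.

Lemma theta_c_spec : 2 <= theta_c /\ mfun theta_c = 0.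
Proof. unfold theta_c. apply epsilon_spec, mfun_has_zero. Qed.

Definition gain (t : R) : R := if Rle_dec t theta_c then 0 else mfun t.

(** For fixed a, [phi t a] increases with t. Below [theta_c] this compares with [phi theta_c], whose
    bound is 0. Above it, evaluation at [crit theta_c] shows 0 = m(theta_c) <= m(t), so the bound
    max(0, m(t)) is m(t). *)
Lemma phi_le_gain (t a : R) : 0 <= a < 1 -> phi t a <= gain t.
Proof.
  intros Ha. destruct theta_c_spec as [Hc Hm]. unfold gain. destruct Rle_dec as [Ht|Ht].
  - apply Rle_trans with (phi theta_c a).
    + unfold phi. pose proof (pow2_ge_0 a). nra.
    + pose proof (phi_le_max theta_c a Hc Ha) as H. rewrite Hm, Rmax_left in H; lra.
  - assert (H2 : 2 <= t) by lra.
    pose proof (phi_le_max t a H2 Ha) as H. rewrite Rmax_right in H; [exact H|].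
    destruct (crit_spec _ Hc) as [H3 _]. destruct (crit_spec _ H2) as [H4 _].
    rewrite <- Hm, mfun_phi_crit by assumption.
    apply Rle_trans with (phi t (crit theta_c)); [|apply phi_le_mfun; lra].
    unfold phi. pose proof (pow2_ge_0 (crit theta_c)). nra.
Qed.

(** Supplies the fraction of mass that the lower bound puts on one site. *)
Lemma gain_attained (t : R) : exists a, 0 <= a < 1 /\ phi t a = gain t.
Proof.
  destruct theta_c_spec as [Hc Hm]. unfold gain. destruct Rle_dec as [Ht|Ht].
  - exists 0. split; [lra|]. unfold phi. rewrite Rminus_0_r, ln_1. ring.
  - exists (crit t). destruct (crit_spec t ltac:(lra)) as [H _]. split; [lra|].
    symmetry. apply mfun_phi_crit. lra.
Qed.

Lemma Ffree_gain (beta B : R) : Ffree beta B = ln (B * PI * exp 1) + gain (beta * B ^ 2).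
Proof. unfold Ffree, gain. destruct Rle_dec; ring. Qed.

(** * The energy against the quartic term *)

Lemma rsum_filter_const (n : nat) (b : nat -> bool) (a : R) :
  rsum n (fun y => if b y then a else 0) = INR (length (filter b (seq 0 n))) * a.
Proof.
  induction n as [|n IH]; [rewrite rsum_0; simpl; ring|].
  rewrite rsum_S, IH, seq_S, filter_app, length_app, plus_INR. simpl.
  destruct (b n); simpl; ring.
Qed.

Lemma abs2_nonneg (n : nat) (c : nat -> R) (x : nat) : 0 <= abs2 n c x.
Proof. unfold abs2. pose proof (pow2_ge_0 (c x)). pose proof (pow2_ge_0 (c (n + x)%nat)). lra. Qed.

(** From |u - v|^2 <= 2 |u|^2 + 2 |v|^2, summed over all ordered adjacent pairs: each endpoint then
    occurs at most D times, the second one by symmetry of [adj] after exchanging the sums. *)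
Lemma edge_sum_bounds (n : nat) (adj : nat -> nat -> bool) (h : R) (D : nat) (c : nat -> R) :
  simple_graph n adj -> (forall x, (x < n)%nat -> (degree n adj x <= D)%nat) -> 0 < h ->
  0 <= rsum n (fun x => rsum n (fun y =>
      if (Nat.ltb x y && adj x y)%bool then
        ((c x - c y) ^ 2 + (c (n + x)%nat - c (n + y)%nat) ^ 2) / h ^ 2
      else 0)) <= 4 * INR D / h ^ 2 * Nmass n c.
Proof.
  intros [Hsym _] Hdeg Hh.
  assert (Hh2 : 0 < / h ^ 2) by (apply Rinv_0_lt_compat, pow_lt, Hh).
  split.
  - apply rsum_nonneg. intros x _. apply rsum_nonneg. intros y _.
    destruct (_ && _)%bool; [|lra]. unfold Rdiv.
    pose proof (pow2_ge_0 (c x - c y)). pose proof (pow2_ge_0 (c (n + x)%nat - c (n + y)%nat)).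
    apply Rmult_le_pos; lra.
  - apply Rle_trans with (rsum n (fun x => rsum n (fun y =>
      (if adj x y then 2 / h ^ 2 * abs2 n c x else 0)
      + (if adj x y then 2 / h ^ 2 * abs2 n c y else 0)))).
    + apply rsum_le. intros x _. apply rsum_le. intros y _.
      pose proof (abs2_nonneg n c x). pose proof (abs2_nonneg n c y).
      assert (0 <= 2 / h ^ 2) by (unfold Rdiv; lra).
      destruct (Nat.ltb x y); destruct (adj x y); simpl andb; cbn iota; try nra; try lra.
      unfold abs2, Rdiv.
      pose proof (pow2_ge_0 (c x + c y)). pose proof (pow2_ge_0 (c (n + x)%nat + c (n + y)%nat)).
      set (w := / h ^ 2) in *. nra.
    + assert (Hrow : forall f, rsum n (fun x => rsum n (fun y =>
        if adj x y then f x else 0)) = rsum n (fun x => INR (degree n adj x) * f x)).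
      { intros f. apply rsum_ext. intros x _. rewrite rsum_filter_const. reflexivity. }
      assert (Hbound : rsum n (fun x => INR (degree n adj x) * (2 / h ^ 2 * abs2 n c x))
        <= INR D * (2 / h ^ 2) * Nmass n c).
      { unfold Nmass. rewrite <- rsum_scal. apply rsum_le. intros x Hx.
        rewrite Rmult_assoc. apply Rmult_le_compat_r.
        - apply Rmult_le_pos; [unfold Rdiv; lra|apply abs2_nonneg].
        - apply le_INR, Hdeg, Hx. }
      rewrite (rsum_ext n _ (fun x => rsum n (fun y => if adj x y then 2 / h ^ 2 * abs2 n c x else 0)
        + rsum n (fun y => if adj x y then 2 / h ^ 2 * abs2 n c y else 0)))
        by (intros; apply rsum_plus).
      rewrite rsum_plus, (Hrow (fun x => 2 / h ^ 2 * abs2 n c x)).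
      rewrite (rsum_swap n n).
      rewrite (rsum_ext n (fun j => rsum n _) (fun y => rsum n (fun x => if adj y x then 2 / h ^ 2 * abs2 n c y else 0))).
      * rewrite (Hrow (fun x => 2 / h ^ 2 * abs2 n c x)). unfold Rdiv in *. lra.
      * intros y Hy. apply rsum_ext. intros x Hx. rewrite Hsym by assumption. reflexivity.
Qed.

(** The edge sum has weight 2 beta / n and is at most 4 D B n / h^2 on the ball; n cancels and
    leaves the constant 8 beta D B / h^2. *)
Lemma energy_bounds (n : nat) (adj : nat -> nat -> bool) (beta B h : R) (D : nat) (c : nat -> R) :
  (0 < n)%nat -> 0 <= beta -> 0 < h ->
  simple_graph n adj -> max_degree_is n adj D -> Nmass n c <= B * INR n ->
  beta / INR n * rsum n (fun x => abs2 n c x ^ 2) - 8 * beta * INR D * B / h ^ 2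
  <= - beta * Hamil n adj h c
  <= beta / INR n * rsum n (fun x => abs2 n c x ^ 2).
Proof.
  intros Hn Hb Hh Hg [Hdeg _] HN.
  pose proof (edge_sum_bounds n adj h D c Hg Hdeg Hh) as HE.
  unfold Hamil. set (E := rsum n (fun x => rsum n _)) in *.
  set (S4 := rsum n (fun x => abs2 n c x ^ 2)).
  assert (HnR : 0 < INR n) by (apply lt_0_INR; exact Hn).
  assert (Hh2 : 0 < / h ^ 2) by (apply Rinv_0_lt_compat, pow_lt, Hh).
  pose proof (pos_INR D) as HD.
  assert (HE2 : E <= 4 * INR D / h ^ 2 * (B * INR n)).
  { eapply Rle_trans; [apply HE|]. apply Rmult_le_compat_l; [|exact HN].
    unfold Rdiv. apply Rmult_le_pos; lra. }
  assert (Hbn : 0 <= beta / INR n) by (apply Rdiv_le_0_compat; lra).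
  replace (- beta * (2 / INR n * E - 1 / INR n * S4))
    with (beta / INR n * S4 - 2 * (beta / INR n * E)) by (field; lra).
  assert (beta / INR n * E <= beta / INR n * (4 * INR D / h ^ 2 * (B * INR n)))
    by (apply Rmult_le_compat_l; lra).
  replace (beta / INR n * (4 * INR D / h ^ 2 * (B * INR n)))
    with (4 * beta * INR D * B / h ^ 2) in H by (field; lra).
  assert (0 <= beta / INR n * E) by (apply Rmult_le_pos; lra).
  unfold Rdiv in *. lra.
Qed.

(** * Upper bound *)

(** The weak upper inequality lets x = n be served by j = n - 1, keeping j < n. *)
Lemma nat_floor_lt (n : nat) (x : R) :
  (0 < n)%nat -> 0 <= x <= INR n -> exists j, (j < n)%nat /\ INR j <= x <= INR j + 1.
Proof.
  intros Hn Hx. induction n as [|n IH]; [lia|].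
  rewrite S_INR in Hx. destruct (Rle_dec (INR n) x) as [H|H].
  - exists n. split; [lia|lra].
  - destruct n as [|n]; [simpl in H; lra|].
    destruct IH as (j & Hj & Hjx); [lia|lra|]. exists j. split; [lia|lra].
Qed.

Lemma rprod_pairs (n : nat) (f : nat -> R) :
  rprod (2 * n) f = rprod n (fun x => f x * f (n + x)%nat).
Proof.
  replace (2 * n)%nat with (n + n)%nat by lia. rewrite rprod_add, rprod_mult. reflexivity.
Qed.

Lemma rsum_split (m : nat) (b : nat -> bool) (f : nat -> R) :
  rsum m f = rsum m (fun i => if b i then f i else 0) + rsum m (fun i => if b i then 0 else f i).
Proof. rewrite <- rsum_plus. apply rsum_ext. intros i _. destruct (b i); lra. Qed.

(* Sites above the threshold [u] pay a factor [exp (-2 tau)] each; the others are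
   controlled by the Gaussian weight. *)
Lemma product_weight_ge (n : nat) (v : nat -> R) (tau c u : R) :
  let big := fun x => if Rlt_dec u (abs2 n v x) then true else false in
  exp (- (2 * tau * rsum n (fun x => if big x then 1 else 0)
          + c * rsum n (fun x => if big x then 0 else abs2 n v x)))
  <= rprod (2 * n) (fun i => exp (- tau) + exp (- (c * v i ^ 2))).
Proof.
  intros big. rewrite rprod_pairs.
  rewrite <- !rsum_scal, <- rsum_plus.
  replace (- rsum n _) with (rsum n (fun x => -1 * (2 * tau * (if big x then 1 else 0)
    + c * (if big x then 0 else abs2 n v x)))) by (rewrite rsum_scal; lra).
  rewrite <- rprod_exp. apply rprod_le. intros x _. split; [left; apply exp_pos|].
  pose proof (exp_pos (- tau)). pose proof (exp_pos (- (c * v x ^ 2))).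
  pose proof (exp_pos (- (c * v (n + x)%nat ^ 2))).
  destruct (big x).
  - replace (-1 * _) with (- tau + - tau) by lra. rewrite exp_plus.
    apply Rmult_le_compat; lra.
  - unfold abs2. replace (-1 * _) with (- (c * v x ^ 2) + - (c * v (n + x)%nat ^ 2)) by lra.
    rewrite exp_plus. apply Rmult_le_compat; lra.
Qed.

(** In order: the factors n^6 repaid for at most B sqrt n large sites; the quartic sum of the small
    sites; the rounding of the mass fraction to the grid; n times the variational maximum; the
    Gaussian exponent of the small sites, at most n. *)
Definition upper_exponent (n : nat) (beta B : R) : R :=
  6 * B * sqrt (INR n) * ln (INR n) + beta * B * sqrt (INR n) + 3 * (beta * B ^ 2)
  + INR n * gain (beta * B ^ 2) + INR n.

(** Fraction of the mass left to the small sites, rounded up; it never drops below 1/n, so the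
    Gaussian of precision 1 / (B b) makes sense. *)
Definition frac (n j : nat) : R := INR (S j) / INR n.

Lemma frac_bounds (n j : nat) : (j < n)%nat -> / INR n <= frac n j <= 1.
Proof.
  intros Hj. assert (Hn : 0 < INR n) by (apply lt_0_INR; lia). unfold frac. split.
  - unfold Rdiv. rewrite <- (Rmult_1_l (/ INR n)) at 1.
    apply Rmult_le_compat_r; [left; apply Rinv_0_lt_compat, Hn|]. apply (le_INR 1). lia.
  - apply Rle_div_l; [exact Hn|]. rewrite Rmult_1_l. apply le_INR. lia.
Qed.

(** A single term of the sum suffices, the one whose grid fraction matches v. With b = [frac n j],
    the factor exp (- n ln b) compensates the Gaussian volume (pi B b)^n, so that all terms
    integrate to about (pi B)^n. *)
Lemma integrand_upper (n : nat) (adj : nat -> nat -> bool) (beta B h : R) (D : nat) (v : nat -> R) :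
  (0 < n)%nat -> 0 <= beta -> 0 < B -> 0 < h ->
  simple_graph n adj -> max_degree_is n adj D ->
  integrand n adj h beta B v <=
  exp (upper_exponent n beta B) *
  rsum n (fun j => exp (- (INR n * ln (frac n j))) *
    rprod (2 * n) (fun i => exp (- (3 * ln (INR n))) + exp (- (/ (B * frac n j) * v i ^ 2)))).
Proof.
  intros Hn Hb HB Hh Hg Hd.
  assert (HnR : 1 <= INR n) by (apply (le_INR 1); lia).
  pose (F := fun j => exp (- (INR n * ln (frac n j))) *
    rprod (2 * n) (fun i => exp (- (3 * ln (INR n))) + exp (- (/ (B * frac n j) * v i ^ 2)))).
  assert (HF : forall j, 0 <= F j).
  { intros j. unfold F. apply Rmult_le_pos; [left; apply exp_pos|].
    apply rprod_nonneg. intros i _.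
    apply Rplus_le_le_0_compat; left; apply exp_pos. }
  unfold integrand. destruct Rle_dec as [HN|HN].
  2:{ apply Rmult_le_pos; [left; apply exp_pos|]. apply rsum_nonneg. intros; apply HF. }
  set (N := INR n) in *. set (sn := sqrt N).
  assert (Hsn : sn * sn = N) by (apply sqrt_sqrt; lra).
  assert (Hsn0 : 0 < sn) by (apply sqrt_lt_R0; lra).
  pose (big := fun x => if Rlt_dec sn (abs2 n v x) then true else false).
  set (kap := rsum n (fun x => if big x then 1 else 0)).
  set (s := rsum n (fun x => if big x then abs2 n v x else 0)).
  set (sig := rsum n (fun x => if big x then 0 else abs2 n v x)).
  assert (Hsplit : Nmass n v = s + sig) by apply rsum_split.
  assert (Hs0 : 0 <= s).
  { apply rsum_nonneg. intros x _. destruct (big x); [apply abs2_nonneg|lra]. }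
  assert (Hsig0 : 0 <= sig).
  { apply rsum_nonneg. intros x _. destruct (big x); [lra|apply abs2_nonneg]. }
  assert (Hkap : kap <= B * sn).
  { assert (sn * kap <= s).
    { unfold kap, s. rewrite <- rsum_scal. apply rsum_le. intros x _. unfold big.
      destruct Rlt_dec; lra. }
    apply Rmult_le_reg_l with sn; [exact Hsn0|]. nra. }
  (* Large sites are bounded as if they formed a single one; small sites have |f_x|^4 <= sqrt n
     |f_x|^2. *)
  assert (HS4 : rsum n (fun x => abs2 n v x ^ 2) <= s ^ 2 + sn * (B * N)).
  { rewrite (rsum_split n big). apply Rplus_le_compat.
    - unfold s. eapply Rle_trans; [|apply rsum_sq_le].
      + apply rsum_le. intros x _. destruct (big x); lra.
      + intros x _. destruct (big x); [apply abs2_nonneg|lra].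
    - apply Rle_trans with (sn * sig).
      + unfold sig. rewrite <- rsum_scal. apply rsum_le. intros x _.
        pose proof (abs2_nonneg n v x). unfold big. destruct Rlt_dec; nra.
      + apply Rmult_le_compat_l; lra. }
  set (t := beta * B ^ 2). assert (Ht : 0 <= t) by (apply Rmult_le_pos; [lra|apply pow2_ge_0]).
  set (a := s / (B * N)).
  assert (HBN : 0 < B * N) by (apply Rmult_lt_0_compat; lra).
  assert (Hsa : s = a * (B * N)) by (unfold a; field; lra).
  assert (Ha : 0 <= a <= 1).
  { split; [apply Rdiv_le_0_compat; lra|apply Rle_div_l; lra]. }
  (* Here b = (j + 1) / N is 1 - a rounded up: hence sig <= B N b, while a exceeds 1 - b by at most
     1/N. *)
  destruct (nat_floor_lt n (N * (1 - a)) Hn) as (j & Hj & Hjx); [fold N; nra|].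
  apply Rle_trans with (exp (upper_exponent n beta B) * F j).
  2:{ apply Rmult_le_compat_l; [left; apply exp_pos|].
      apply (rsum_term_le n F j Hj). intros; apply HF. }
  pose proof (frac_bounds n j Hj) as Hfr. unfold F. set (b := frac n j) in *.
  assert (HbN : b * N = INR j + 1) by (unfold b, frac; rewrite S_INR; fold N; field; lra).
  fold N in Hfr. assert (Hb0 : 0 < b).
  { apply Rlt_le_trans with (/ N); [apply Rinv_0_lt_compat|]; lra. }
  pose proof (product_weight_ge n v (3 * ln N) (/ (B * b)) sn) as HP. cbv zeta in HP.
  fold big kap sig in HP.
  eapply Rle_trans; [|apply Rmult_le_compat_l; [left; apply exp_pos|
    apply Rmult_le_compat_l; [left; apply exp_pos|exact HP]]].
  rewrite <- !exp_plus. apply exp_le_compat.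
  eapply Rle_trans; [apply (energy_bounds n adj beta B h D v); auto|]. fold N.
  assert (HlnN : 0 <= ln N) by (rewrite <- ln_1; apply ln_le; lra).
  assert (Hk2 : ln N * kap <= ln N * (B * sn)) by (apply Rmult_le_compat_l; lra).
  assert (Hcs : / (B * b) * sig <= N).
  { apply Rmult_le_reg_l with (B * b); [apply Rmult_lt_0_compat; lra|].
    rewrite <- Rmult_assoc, Rinv_r, Rmult_1_l; [|apply Rgt_not_eq, Rmult_lt_0_compat; lra]. nra. }
  assert (Hphi : t * (1 - b) ^ 2 + ln b <= gain t).
  { pose proof (phi_le_gain t (1 - b) ltac:(lra)) as H. unfold phi in H.
    replace (1 - (1 - b)) with b in H by ring. exact H. }
  assert (HE1 : beta / N * rsum n (fun x => abs2 n v x ^ 2) <= N * (t * a ^ 2) + beta * B * sn).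
  { apply Rle_trans with (beta / N * (s ^ 2 + sn * (B * N))).
    - apply Rmult_le_compat_l; [apply Rdiv_le_0_compat; lra|exact HS4].
    - right. rewrite Hsa. unfold t. field. lra. }
  (* The 3 comes from (x + 1)^2 <= x^2 + 3 N for 0 <= x <= N and N >= 1, with x = N (1 - b). *)
  assert (HE2 : N * (t * a ^ 2) <= N * (t * (1 - b) ^ 2) + 3 * t).
  { assert (Hna : N * a <= N * (1 - b) + 1) by nra.
    assert (N * a ^ 2 <= N * (1 - b) ^ 2 + 3).
    { apply Rmult_le_reg_l with N; [lra|].
      replace (N * (N * a ^ 2)) with ((N * a) ^ 2) by ring.
      replace (N * (N * (1 - b) ^ 2 + 3)) with ((N * (1 - b)) ^ 2 + 3 * N) by ring.
      assert (0 <= N * a) by (apply Rmult_le_pos; lra).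
      assert (0 <= N * (1 - b) <= N) by nra.
      apply Rle_trans with ((N * (1 - b) + 1) ^ 2); [apply pow_incr; lra|]. nra. }
    nra. }
  assert (HE3 : N * (t * (1 - b) ^ 2) + N * ln b <= N * gain t).
  { rewrite <- Rmult_plus_distr_l. apply Rmult_le_compat_l; lra. }
  unfold upper_exponent. fold N t sn. lra.
Qed.

Lemma msum_plus_const (K k : nat) (a : R) (f : R -> R) :
  msum K k (fun t => a + f t) = 2 * INR K * a + msum K k f.
Proof.
  unfold msum. rewrite rsum_plus, rsum_const, !mult_INR.
  pose proof (INR_S_pos k). change (INR 2) with 2. set (r := rsum _ _). field. lra.
Qed.

Lemma rsm_rprod (d K k : nat) (u : nat -> R -> R) :
  rsm d K (fun v => rprod d (fun i => u i (v i))) k = rprod d (fun i => msum K k (u i)).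
Proof.
  unfold rsm. unfold gpt.
  rewrite (gridsum_rprod d (2 * S k * K)
    (fun i j => u i (- INR K + (INR j + / 2) / INR (S k)))).
  rewrite <- rprod_const, <- rprod_mult. reflexivity.
Qed.

Lemma rsm_le (d K k : nat) (f g : (nat -> R) -> R) :
  (0 < K)%nat -> (forall v, inbox (INR K) v -> f v <= g v) -> rsm d K f k <= rsm d K g k.
Proof.
  intros HK H. unfold rsm. apply Rmult_le_compat_l.
  - apply pow_le. left. apply Rinv_0_lt_compat, INR_S_pos.
  - apply gridsum_le; [lia|]. intros p Hp. apply H, gpt_inbox, Hp.
Qed.

Lemma rsm_scal (d K k : nat) (a : R) (f : (nat -> R) -> R) :
  rsm d K (fun v => a * f v) k = a * rsm d K f k.
Proof. unfold rsm. rewrite gridsum_scal. ring. Qed.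

Lemma rsm_plus (d K k : nat) (f g : (nat -> R) -> R) :
  rsm d K (fun v => f v + g v) k = rsm d K f k + rsm d K g k.
Proof. unfold rsm. rewrite gridsum_plus. ring. Qed.

Lemma rsm_rsum (d K k m : nat) (F : nat -> (nat -> R) -> R) :
  rsm d K (fun v => rsum m (fun j => F j v)) k = rsum m (fun j => rsm d K (F j) k).
Proof. unfold rsm. rewrite gridsum_rsum, rsum_scal. reflexivity. Qed.

Lemma gauss_box_le (K : nat) (c : R) : 0 < c -> gauss_box K c <= sqrt (PI / c).
Proof.
  intros Hc. rewrite <- (sqrt_pow2 (gauss_box K c)) by apply gauss_box_nonneg.
  apply sqrt_le_1_alt, gauss_box_sq_bounds, Hc.
Qed.

Lemma boxK_pos (n : nat) (B : R) : (0 < boxK n B)%nat.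
Proof. unfold boxK. lia. Qed.

Lemma Zpart_le_sum (n : nat) (adj : nat -> nat -> bool) (beta B h : R) (D : nat) :
  (0 < n)%nat -> 0 <= beta -> 0 < B -> 0 < h ->
  simple_graph n adj -> max_degree_is n adj D ->
  Zpart n adj h beta B <=
  exp (upper_exponent n beta B) *
  rsum n (fun j => exp (- (INR n * ln (frac n j))) *
    (2 * INR (boxK n B) * exp (- (3 * ln (INR n))) + gauss_box (boxK n B) (/ (B * frac n j))) ^ (2 * n)).
Proof.
  intros Hn Hb HB Hh Hg Hd. set (K := boxK n B).
  apply (Un_cv_le_eventually (riemann_sum n adj h beta B) (fun k =>
    exp (upper_exponent n beta B) *
    rsum n (fun j => exp (- (INR n * ln (frac n j))) *
      (2 * INR K * exp (- (3 * ln (INR n)))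
       + msum K k (fun t => exp (- (/ (B * frac n j) * t ^ 2)))) ^ (2 * n))) _ _ 0).
  - intros k _. rewrite riemann_sum_rsm.
    eapply Rle_trans.
    { apply rsm_le; [apply boxK_pos|]. intros v _. apply (integrand_upper n adj beta B h D v); auto. }
    right. rewrite rsm_scal, rsm_rsum. f_equal. apply rsum_ext. intros j _.
    rewrite rsm_scal. f_equal.
    rewrite (rsm_rprod (2 * n) _ k
      (fun _ t => exp (- (3 * ln (INR n))) + exp (- (/ (B * frac n j) * t ^ 2)))).
    rewrite rprod_const, msum_plus_const. reflexivity.
  - apply Zpart_limit, Hn.
  - apply CV_mult; [apply Un_cv_const|].
    apply (Un_cv_rsum n (fun k j => exp (- (INR n * ln (frac n j))) *
      (2 * INR K * exp (- (3 * ln (INR n)))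
       + msum K k (fun t => exp (- (/ (B * frac n j) * t ^ 2)))) ^ (2 * n))).
    intros j Hj. apply CV_mult; [apply Un_cv_const|].
    apply (Un_cv_pow (fun k => 2 * INR K * exp (- (3 * ln (INR n)))
       + msum K k (fun t => exp (- (/ (B * frac n j) * t ^ 2))))).
    apply CV_plus; [apply Un_cv_const|]. apply Un_cv_msum_gauss.
    left. apply Rinv_0_lt_compat, Rmult_lt_0_compat; [exact HB|].
    eapply Rlt_le_trans; [|apply frac_bounds, Hj]. apply Rinv_0_lt_compat, lt_0_INR, Hn.
Qed.

Lemma pow_le_exp (y : R) (m : nat) : 0 <= y -> (1 + y) ^ m <= exp (INR m * y).
Proof.
  intros Hy. apply Rle_trans with (exp y ^ m).
  - apply pow_incr. pose proof (exp_ineq1_le y). lra.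
  - right. rewrite <- rprod_const, rprod_exp, rsum_const. reflexivity.
Qed.

Lemma exp_INR_mult (m : nat) (y : R) : exp (INR m * y) = exp y ^ m.
Proof. rewrite <- rprod_const, rprod_exp, rsum_const. reflexivity. Qed.

(** Explains the penalty n^(-3) per coordinate: integrated over a box of side O(n) and divided by
    the Gaussian integral bound r >= sqrt (pi B) / n, it is a relative error O(1/n). Over 2 n
    coordinates this multiplies to at most exp q. The summand ln n counts the n terms. *)
Lemma Zpart_upper (n : nat) (adj : nat -> nat -> bool) (beta B h : R) (D : nat) :
  (0 < n)%nat -> 0 <= beta -> 0 < B -> 0 < h ->
  simple_graph n adj -> max_degree_is n adj D ->
  Zpart n adj h beta B <=
  exp (upper_exponent n beta B + ln (INR n) + INR n * ln (PI * B) + 4 * (B + 2) / sqrt (PI * B)).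
Proof.
  intros Hn Hb HB Hh Hg Hd.
  eapply Rle_trans; [apply (Zpart_le_sum n adj beta B h D); auto|].
  assert (HnR : 1 <= INR n) by (apply (le_INR 1); lia).
  assert (HPB : 0 < PI * B) by (apply Rmult_lt_0_compat; [apply PI_RGT_0|exact HB]).
  pose proof (boxK_bounds n B HB) as HK. set (K := INR (boxK n B)) in *.
  set (T := exp (- (3 * ln (INR n)))).
  assert (HT : T * (INR n * INR n * INR n) = 1).
  { unfold T. rewrite <- (exp_ln (INR n)) at 2 3 4 by lra. rewrite <- !exp_plus, <- exp_0. f_equal. ring. }
  assert (HT0 : 0 < T) by apply exp_pos.
  set (q := 4 * (B + 2) / sqrt (PI * B)).
  assert (HsPB : 0 < sqrt (PI * B)) by (apply sqrt_lt_R0; exact HPB).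
  apply Rle_trans with (exp (upper_exponent n beta B) *
    rsum n (fun _ => exp (INR n * ln (PI * B) + q))).
  - apply Rmult_le_compat_l; [left; apply exp_pos|]. apply rsum_le. intros j Hj.
    pose proof (frac_bounds n j Hj) as Hfr. set (b := frac n j) in *.
    assert (Hin : 0 < / INR n) by (apply Rinv_0_lt_compat; lra).
    assert (Hin1 : / INR n * INR n = 1) by (apply Rinv_l; lra).
    assert (Hc : 0 < / (B * b)) by (apply Rinv_0_lt_compat, Rmult_lt_0_compat; lra).
    pose proof (gauss_box_le (boxK n B) _ Hc) as HG.
    replace (PI / / (B * b)) with (PI * B * b) in HG by (field; split; lra).
    rewrite sqrt_mult in HG by lra.
    assert (Hsb : / INR n <= sqrt b).
    { rewrite <- (sqrt_pow2 (/ INR n)) by lra. apply sqrt_le_1_alt.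
      apply Rle_trans with (/ INR n); [simpl; nra|lra]. }
    set (r := sqrt (PI * B) * sqrt b) in *.
    assert (Hr : 0 < r) by (apply Rmult_lt_0_compat; lra).
    assert (Hr2 : r * r = PI * B * b).
    { unfold r. rewrite <- (sqrt_sqrt (PI * B)) at 3 by lra.
      rewrite <- (sqrt_sqrt b) at 3 by lra. ring. }
    assert (Hy : INR (2 * n) * (2 * K * T / r) <= q).
    { rewrite mult_INR. change (INR 2) with 2.
      assert (HK2 : K <= (B + 2) * INR n) by nra.
      assert (Hrn : sqrt (PI * B) <= r * INR n).
      { unfold r. rewrite Rmult_assoc. rewrite <- (Rmult_1_r (sqrt (PI * B))) at 1.
        apply Rmult_le_compat_l; nra. }
      unfold q. apply (Rle_div_r _ _ _ HsPB).
      apply Rle_trans with (2 * INR n * (2 * ((B + 2) * INR n) * T / r) * (r * INR n)).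
      - assert (0 < / r) by (apply Rinv_0_lt_compat; lra).
        assert (0 <= T * / r) by (apply Rmult_le_pos; lra).
        assert (0 <= K) by nra.
        apply Rmult_le_compat; [|lra| |exact Hrn].
        + repeat (apply Rmult_le_pos; try lra).
        + apply Rmult_le_compat_l; [lra|]. unfold Rdiv. rewrite !Rmult_assoc.
          apply Rmult_le_compat_l; [lra|]. rewrite <- (Rmult_assoc (B + 2)).
          apply Rmult_le_compat_r; lra.
      - right. replace (2 * INR n * (2 * ((B + 2) * INR n) * T / r) * (r * INR n))
          with (4 * (B + 2) * (T * (INR n * INR n * INR n))) by (field; lra).
        rewrite HT. ring. }
    apply Rle_trans with (exp (- (INR n * ln b)) * (r * (1 + 2 * K * T / r)) ^ (2 * n)).
    + apply Rmult_le_compat_l; [left; apply exp_pos|]. apply pow_incr.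
      assert (0 <= K * T) by (apply Rmult_le_pos; nra).
      split; [pose proof (gauss_box_nonneg (boxK n B) (/ (B * b))); nra|].
      replace (r * (1 + 2 * K * T / r)) with (2 * K * T + r) by (field; lra). lra.
    + rewrite Rpow_mult_distr, pow_mult.
      replace (r ^ 2) with (PI * B * b) by (rewrite <- Hr2; ring).
      assert (Hpow : (PI * B * b) ^ n = exp (INR n * ln (PI * B) + INR n * ln b)).
      { rewrite <- Rmult_plus_distr_l, <- ln_mult, exp_INR_mult, exp_ln by nra. reflexivity. }
      rewrite Hpow.
      assert (Hpe : (1 + 2 * K * T / r) ^ (2 * n) <= exp q).
      { eapply Rle_trans; [apply pow_le_exp|apply exp_le_compat, Hy].
        apply Rdiv_le_0_compat; [|exact Hr]. apply Rmult_le_pos; nra. }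
      eapply Rle_trans; [apply Rmult_le_compat_l; [left; apply exp_pos|];
        apply Rmult_le_compat_l; [left; apply exp_pos|exact Hpe]|].
      rewrite <- !exp_plus. apply exp_le_compat. lra.
  - rewrite rsum_const. rewrite <- (exp_ln (INR n)) at 1 by lra. rewrite <- !exp_plus.
    apply exp_le_compat. lra.
Qed.

(** * Lower bound *)

(** The distinguished site is confined to a square of side 1/2 with lower left corner p on the real
    axis; there its mass lies between p^2 and (p + 1/2)^2 + 1/4 = p^2 + p + 1/2. *)
Definition window (p t : R) : R :=
  if Rle_dec p t then if Rle_dec t (p + / 2) then 1 else 0 else 0.

Lemma window_bounds (p t : R) : 0 <= window p t <= 1.
Proof. unfold window. repeat destruct Rle_dec; lra. Qed.

Lemma msum_window_ge (K k : nat) (p : R) :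
  (0 < K)%nat -> 0 <= p -> p + / 2 <= INR K -> / 2 - / INR (S k) <= msum K k (window p).
Proof.
  intros HK Hp HpK. unfold msum.
  assert (HKR : 1 <= INR K) by (apply (le_INR 1); lia).
  assert (Hx : 1 <= INR (S k)) by (apply (le_INR 1); lia).
  assert (Hm : INR (2 * S k * K) = 2 * INR (S k) * INR K) by (rewrite !mult_INR; reflexivity).
  set (x := INR (S k)) in *.
  apply Rmult_le_reg_l with x; [lra|]. rewrite <- Rmult_assoc, Rinv_r, Rmult_1_l by lra.
  rewrite Rmult_minus_distr_l, Rinv_r by lra.
  eapply Rle_trans; [|eapply Rle_trans; [
    apply (count_ge (2 * S k * K) ((p + INR K) * x - / 2) ((p + / 2 + INR K) * x - / 2))|]].
  - lra.
  - nra.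
  - rewrite Hm. nra.
  - apply rsum_le. intros j _. unfold window.
    set (y := - INR K + (INR j + / 2) / x).
    assert (Hj : INR j = (y + INR K) * x - / 2) by (unfold y; field; lra).
    rewrite Hj. repeat destruct Rle_dec; try lra; nra.
Qed.

Lemma rprod_first (m : nat) (f : nat -> R) :
  rprod (S m) f = f O * rprod m (fun i => f (S i)).
Proof.
  change (S m) with (1 + m)%nat. rewrite rprod_add. simpl. ring.
Qed.

(** With n = [S m] sites, the coordinates 0 and [S m] are the real and imaginary parts of site 0;
    all others get a Gaussian weight. *)
Definition tilt (m : nat) (p c : R) (i : nat) (t : R) : R :=
  if Nat.eqb i 0 then window p t
  else if Nat.eqb i (S m) then window 0 t
  else exp (- (c * t ^ 2)).

Definition rest_mass (m : nat) (v : nat -> R) : R := rsum m (fun x => abs2 (S m) v (S x)).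

Lemma Nmass_rest (m : nat) (v : nat -> R) :
  Nmass (S m) v = abs2 (S m) v 0 + rest_mass m v.
Proof. unfold Nmass, rest_mass. apply rsum_first. Qed.

(** [g] is abstract so that one regrouping serves both point values [f (v i)] and midpoint sums
    [msum K k f]. *)
Lemma rprod_tilt_pairs (m : nat) (g : (R -> R) -> nat -> R) (p c : R) :
  rprod (2 * S m) (fun i => g (tilt m p c i) i) =
  g (window p) O * g (window 0) (S m) *
  rprod m (fun x => g (fun t => exp (- (c * t ^ 2))) (S x)
                    * g (fun t => exp (- (c * t ^ 2))) (S m + S x)%nat).
Proof.
  rewrite rprod_pairs, rprod_first. f_equal.
  - rewrite Nat.add_0_r. f_equal.
    assert (H : tilt m p c (S m) = window 0); [|rewrite H; reflexivity].
    apply functional_extensionality. intros t. unfold tilt. rewrite Nat.eqb_refl. reflexivity.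
  - apply rprod_ext. intros x Hx.
    assert (H : forall i, i <> O -> i <> S m -> tilt m p c i = (fun t => exp (- (c * t ^ 2)))).
    { intros i H0 H1. apply functional_extensionality. intros t. unfold tilt.
      apply Nat.eqb_neq in H0, H1. rewrite H0, H1. reflexivity. }
    rewrite !H by lia. reflexivity.
Qed.

Lemma rprod_tilt (m : nat) (p c : R) (v : nat -> R) :
  rprod (2 * S m) (fun i => tilt m p c i (v i)) =
  window p (v O) * window 0 (v (S m)) * exp (- (c * rest_mass m v)).
Proof.
  rewrite (rprod_tilt_pairs m (fun f i => f (v i))). f_equal.
  replace (- (c * rest_mass m v)) with (rsum m (fun x => - c * abs2 (S m) v (S x)))
    by (rewrite rsum_scal; unfold rest_mass; ring).
  rewrite <- rprod_exp. apply rprod_ext. intros x _. rewrite <- exp_plus. f_equal.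
  unfold abs2. ring.
Qed.

Lemma rsm_tilt (m K k : nat) (p c : R) :
  rsm (2 * S m) K (fun v => rprod (2 * S m) (fun i => tilt m p c i (v i))) k =
  msum K k (window p) * msum K k (window 0) * msum K k (fun t => exp (- (c * t ^ 2))) ^ (2 * m).
Proof.
  rewrite rsm_rprod, (rprod_tilt_pairs m (fun f _ => msum K k f)). f_equal.
  rewrite rprod_const, pow_mult. f_equal. ring.
Qed.

(* Chernoff: the two subtracted exponentials dominate the indicator outside [[L, U]]. *)
Lemma chernoff_indicator (S0 L U lam mu : R) :
  0 <= lam -> 0 <= mu ->
  exp (lam * L) * (exp (- (lam * S0)) - exp (- (mu * U)) * exp (- ((lam - mu) * S0))
     - exp (mu * L) * exp (- ((lam + mu) * S0)))
  <= if Rle_dec S0 U then 1 else 0.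
Proof.
  intros Hl Hm.
  (* In factored form the sign is visible: the bracket is at most 1, it is nonpositive once S0
     leaves [L, U], and the prefactor is at most 1 for S0 >= L. *)
  replace (exp (lam * L) * (exp (- (lam * S0)) - exp (- (mu * U)) * exp (- ((lam - mu) * S0))
     - exp (mu * L) * exp (- ((lam + mu) * S0))))
    with (exp (lam * (L - S0)) * (1 - exp (mu * (S0 - U)) - exp (mu * (L - S0)))).
  2:{ rewrite <- !exp_plus.
      replace (- (mu * U) + - ((lam - mu) * S0)) with (- (lam * S0) + mu * (S0 - U)) by ring.
      replace (mu * L + - ((lam + mu) * S0)) with (- (lam * S0) + mu * (L - S0)) by ring.
      replace (lam * (L - S0)) with (lam * L + - (lam * S0)) by ring.
      rewrite !exp_plus. ring. }
  pose proof (exp_pos (lam * (L - S0))) as H1.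
  pose proof (exp_pos (mu * (S0 - U))) as H2. pose proof (exp_pos (mu * (L - S0))) as H3.
  destruct (Rle_dec L S0) as [HL|HL].
  - assert (exp (lam * (L - S0)) <= 1) by (rewrite <- exp_0; apply exp_le_compat; nra).
    destruct Rle_dec as [HU|HU]; [nra|].
    assert (1 <= exp (mu * (S0 - U))) by (rewrite <- exp_0; apply exp_le_compat; nra). nra.
  - assert (1 <= exp (mu * (L - S0))) by (rewrite <- exp_0; apply exp_le_compat; nra).
    destruct Rle_dec; nra.
Qed.

(** If the windows hold and the rest mass is at most U, the budget hypothesis puts v in the ball,
    and site 0 alone brings (beta / n) (B n a)^2 to the exponent. Otherwise the left side is zero or
    nonpositive. *)
Lemma integrand_lower (m : nat) (adj : nat -> nat -> bool) (beta B h a L U lam mu : R) (D : nat)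
  (v : nat -> R) :
  0 <= beta -> 0 < B -> 0 < h -> 0 <= a ->
  simple_graph (S m) adj -> max_degree_is (S m) adj D ->
  0 <= lam -> 0 <= mu ->
  U + B * INR (S m) * a + sqrt (B * INR (S m) * a) + / 2 <= B * INR (S m) ->
  let p := sqrt (B * INR (S m) * a) in
  let W := fun c => rprod (2 * S m) (fun i => tilt m p c i (v i)) in
  exp (INR (S m) * (beta * B ^ 2 * a ^ 2) - 8 * beta * INR D * B / h ^ 2) * (exp (lam * L) *
    (W lam - exp (- (mu * U)) * W (lam - mu) - exp (mu * L) * W (lam + mu)))
  <= integrand (S m) adj h beta B v.
Proof.
  intros Hb HB Hh Ha Hg Hd Hl Hm HU p W. unfold W. rewrite !rprod_tilt.
  set (S0 := rest_mass m v).
  pose proof (chernoff_indicator S0 L U lam mu Hl Hm) as HC.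
  pose proof (window_bounds p (v O)) as Hw0. pose proof (window_bounds 0 (v (S m))) as Hw1.
  set (E0 := exp (_ - _)). assert (HE0 : 0 < E0) by apply exp_pos.
  assert (Hint : 0 <= integrand (S m) adj h beta B v).
  { unfold integrand. destruct (Rle_dec (Nmass _ _) _); [left; apply exp_pos|lra]. }
  set (br := exp (lam * L) * _) in HC.
  match goal with |- ?lhs <= _ =>
    replace lhs with (E0 * (window p (v O) * window 0 (v (S m)) * br)) by (unfold br; ring) end.
  destruct (Req_dec (window p (v O)) 0) as [Hz|Hp0]; [rewrite Hz; lra|].
  destruct (Req_dec (window 0 (v (S m))) 0) as [Hz|Hp1]; [rewrite Hz; lra|].
  assert (Hv0 : p <= v O <= p + / 2).
  { unfold window in Hp0. repeat destruct Rle_dec; lra. }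
  assert (Hv1 : 0 <= v (S m) <= / 2).
  { unfold window in Hp1. repeat destruct Rle_dec; lra. }
  assert (Hn : 0 < INR (S m)) by apply INR_S_pos. set (N := INR (S m)) in *.
  assert (HBN : 0 < B * N) by (apply Rmult_lt_0_compat; lra).
  assert (Hrho : 0 <= B * N * a) by (apply Rmult_le_pos; lra).
  assert (Hp : 0 <= p) by apply sqrt_pos.
  assert (Hp2 : p * p = B * N * a) by (apply sqrt_sqrt; exact Hrho).
  assert (Hww : 0 <= window p (v O) * window 0 (v (S m)) <= 1) by nra.
  destruct (Rle_dec S0 U) as [HSU|HSU].
  - assert (Hr0 : B * N * a <= abs2 (S m) v 0 <= B * N * a + p + / 2).
    { unfold abs2. rewrite Nat.add_0_r. split; nra. }
    assert (HN : Nmass (S m) v <= B * N) by (rewrite Nmass_rest; fold S0; fold p in HU; lra).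
    apply Rle_trans with (E0 * 1); [|rewrite Rmult_1_r].
    { apply Rmult_le_compat_l; [lra|].
      apply Rle_trans with (window p (v O) * window 0 (v (S m)) * 1); [|lra].
      apply Rmult_le_compat_l; lra. }
    unfold integrand. destruct (Rle_dec (Nmass _ _) _) as [_|HF]; [|exfalso; apply HF; exact HN].
    apply exp_le_compat.
    eapply Rle_trans; [|apply (energy_bounds (S m) adj beta B h D v); auto; lia].
    apply Rplus_le_compat_r. fold N.
    apply Rle_trans with (beta / N * (B * N * a) ^ 2); [right; field; lra|].
    apply Rmult_le_compat_l; [apply Rdiv_le_0_compat; lra|].
    apply Rle_trans with (abs2 (S m) v 0 ^ 2); [apply pow_incr; lra|].
    apply (rsum_term_le (S m) (fun x => abs2 (S m) v x ^ 2)); [lia|]. intros; apply pow2_ge_0.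
  - apply Rle_trans with 0; [|exact Hint].
    assert (0 <= E0 * (window p (v O) * window 0 (v (S m)) * - br)); [|lra].
    apply Rmult_le_pos; [lra|]. apply Rmult_le_pos; lra.
Qed.

Lemma Un_cv_pos_eventually (u : nat -> R) (l : R) :
  Un_cv u l -> 0 < l -> exists N, forall k, (k >= N)%nat -> 0 <= u k.
Proof.
  intros H Hl. destruct (H l Hl) as (N & HN). exists N. intros k Hk.
  specialize (HN k Hk). unfold R_dist in HN. apply Rabs_def2 in HN. lra.
Qed.

Lemma Zpart_ge_tilt (m : nat) (adj : nat -> nat -> bool) (beta B h a L U lam mu : R) (D : nat) :
  0 <= beta -> 0 < B -> 0 < h -> 0 <= a <= 1 ->
  simple_graph (S m) adj -> max_degree_is (S m) adj D ->
  0 <= mu <= lam ->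
  U + B * INR (S m) * a + sqrt (B * INR (S m) * a) + / 2 <= B * INR (S m) ->
  let g := fun c => gauss_box (boxK (S m) B) c ^ (2 * m) in
  let W := g lam - exp (- (mu * U)) * g (lam - mu) - exp (mu * L) * g (lam + mu) in
  0 < W ->
  exp (INR (S m) * (beta * B ^ 2 * a ^ 2) - 8 * beta * INR D * B / h ^ 2)
    * (exp (lam * L) * (/ 16 * W))
  <= Zpart (S m) adj h beta B.
Proof.
  intros Hb HB Hh Ha Hg Hd Hmu HU g W HW.
  set (K := boxK (S m) B). set (n := S m) in *.
  set (p := sqrt (B * INR n * a)) in *.
  set (gk := fun k c => msum K k (fun t => exp (- (c * t ^ 2))) ^ (2 * m)).
  set (Wk := fun k => gk k lam - exp (- (mu * U)) * gk k (lam - mu) - exp (mu * L) * gk k (lam + mu)).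
  set (E0 := exp (_ - _)). assert (HE0 : 0 < E0) by apply exp_pos.
  assert (Hgk : forall c, 0 <= c -> Un_cv (fun k => gk k c) (g c)).
  { intros c Hc. apply (Un_cv_pow (fun k => msum K k (fun t => exp (- (c * t ^ 2))))).
    apply Un_cv_msum_gauss, Hc. }
  assert (HWk : Un_cv Wk W).
  { unfold Wk, W.
    apply (CV_minus (fun k => gk k lam - exp (- (mu * U)) * gk k (lam - mu))
                    (fun k => exp (mu * L) * gk k (lam + mu))).
    - apply (CV_minus (fun k => gk k lam) (fun k => exp (- (mu * U)) * gk k (lam - mu))).
      + apply Hgk; lra.
      + apply (CV_mult (fun _ => exp (- (mu * U)))); [apply Un_cv_const|apply Hgk; lra].
    - apply (CV_mult (fun _ => exp (mu * L))); [apply Un_cv_const|apply Hgk; lra]. }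
  destruct (Un_cv_pos_eventually Wk W HWk HW) as (N0 & HN0).
  (* From k = 3 on each of the two window sums is at least 1/2 - 1/4, whence 1/16; from N0 on [Wk]
     is nonnegative, so this bound may be multiplied by it. *)
  apply (Un_cv_le_eventually (fun k => E0 * (exp (lam * L) * (/ 16 * Wk k)))
    (riemann_sum n adj h beta B) _ _ (N0 + 3)).
  - intros k Hk. specialize (HN0 k ltac:(lia)).
    rewrite riemann_sum_rsm. fold K.
    pose proof (boxK_pos n B) as HK. pose proof (boxK_bounds n B HB) as HKb. fold K in HK, HKb.
    assert (Hn : 1 <= INR n) by (apply (le_INR 1); unfold n; lia).
    assert (HBn : 0 <= B * INR n) by (apply Rmult_le_pos; lra).
    assert (Hp : 0 <= p) by apply sqrt_pos.
    assert (Hp2 : p * p = B * INR n * a) by (apply sqrt_sqrt, Rmult_le_pos; lra).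
    assert (HpK : p + / 2 <= INR K).
    { assert (p * p <= B * INR n) by (rewrite Hp2; nra). pose proof (pow2_ge_0 (p - 1)). nra. }
    assert (Hk4 : / INR (S k) <= / 4).
    { apply Rinv_le_contravar; [lra|]. replace 4 with (INR 4) by (simpl; lra). apply le_INR. lia. }
    pose proof (msum_window_ge K k p HK Hp HpK) as H1.
    pose proof (msum_window_ge K k 0 HK (Rle_refl 0) ltac:(lra)) as H2.
    assert (H12 : / 16 <= msum K k (window p) * msum K k (window 0)) by nra.
    eapply Rle_trans; [|apply rsm_le; [exact HK|];
      intros v _; apply (integrand_lower m adj beta B h a L U lam mu D v); auto; lra].
    fold n p.
    rewrite (rsm_scal (2 * n) K k E0), (rsm_scal (2 * n) K k (exp (lam * L))).
    apply Rmult_le_compat_l; [lra|]. apply Rmult_le_compat_l; [left; apply exp_pos|].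
    set (V := fun c v => rprod (2 * n) (fun i => tilt m p c i (v i))).
    assert (HV : forall c, rsm (2 * n) K (V c) k
      = msum K k (window p) * msum K k (window 0) * gk k c) by (intros; apply rsm_tilt).
    apply Rle_trans with (msum K k (window p) * msum K k (window 0) * Wk k).
    + apply Rmult_le_compat_r; assumption.
    + right. transitivity (rsm (2 * n) K (fun v => V lam v
        + ((- exp (- (mu * U))) * V (lam - mu) v + (- exp (mu * L)) * V (lam + mu) v)) k).
      * rewrite rsm_plus, rsm_plus, !rsm_scal, !HV. unfold Wk. ring.
      * f_equal. apply functional_extensionality. intros v. unfold V. ring.
  - apply (CV_mult (fun _ => E0)); [apply Un_cv_const|].
    apply (CV_mult (fun _ => exp (lam * L))); [apply Un_cv_const|].
    apply (CV_mult (fun _ => / 16)); [apply Un_cv_const|exact HWk].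
  - apply Zpart_limit. unfold n. lia.
Qed.

Lemma ln_le_sub1 (x : R) : 0 < x -> ln x <= x - 1.
Proof. intros Hx. pose proof (exp_ineq1_le (ln x)) as H. rewrite exp_ln in H; lra. Qed.

Lemma ln_1_minus_ge (y : R) : 0 <= y <= / 2 -> - y - 2 * y ^ 2 <= ln (1 - y).
Proof.
  intros Hy. assert (H : ln (/ (1 - y)) <= / (1 - y) - 1).
  { apply ln_le_sub1, Rinv_0_lt_compat. lra. }
  rewrite ln_Rinv in H by lra.
  assert (/ (1 - y) <= 1 + y + 2 * y ^ 2).
  { apply Rmult_le_reg_l with (1 - y); [lra|]. rewrite Rinv_r by lra. nra. }
  lra.
Qed.

Lemma ln_1_plus_ge (y : R) : 0 <= y -> y - y ^ 2 <= ln (1 + y).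
Proof.
  intros Hy. assert (H : ln (/ (1 + y)) <= / (1 + y) - 1).
  { apply ln_le_sub1, Rinv_0_lt_compat. lra. }
  rewrite ln_Rinv in H by lra.
  assert (/ (1 + y) <= 1 - y + y ^ 2).
  { apply Rmult_le_reg_l with (1 + y); [lra|]. rewrite Rinv_r by lra. nra. }
  lra.
Qed.

Lemma bernoulli_sub (y : R) (m : nat) : 0 <= y <= 1 -> 1 - INR m * y <= (1 - y) ^ m.
Proof.
  intros Hy. induction m as [|m IH]; [simpl; lra|].
  rewrite S_INR, <- tech_pow_Rmult. assert (H : (1 - y) ^ m <= 1).
  { apply Rle_trans with (1 ^ m); [apply pow_incr; lra|rewrite pow1; lra]. }
  pose proof (Rmult_le_pos y (1 - (1 - y) ^ m) ltac:(lra) ltac:(lra)). lra.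
Qed.

(* With [lam = m / C], window [C (1 -+ eta)] and [mu = lam eta / 4], each Chernoff tail costs
   [exp (- m eta^2 / 8) <= / 16]. *)
Lemma tilt_bracket_ge (K m : nat) (C eta : R) :
  0 < C -> 0 < eta <= 1 -> 32 <= INR m * eta ^ 2 -> 4 * C <= INR K ^ 2 ->
  let lam := INR m / C in let mu := lam * (eta / 4) in
  let g := fun c => gauss_box K c ^ (2 * m) in
  / 2 * (PI / lam) ^ m <=
  g lam - exp (- (mu * (C * (1 + eta)))) * g (lam - mu) - exp (mu * (C * (1 - eta))) * g (lam + mu).
Proof.
  intros HC Heta Hm HK lam mu g.
  assert (Hm0 : 0 < INR m).
  { assert (0 < eta ^ 2) by (apply pow_lt; lra). nra. }
  assert (Hlam : 0 < lam) by (apply Rdiv_lt_0_compat; lra).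
  assert (HlC : lam * C = INR m) by (unfold lam; field; lra).
  pose proof PI_RGT_0 as HPI.
  assert (HPl : 0 < PI / lam) by (apply Rdiv_lt_0_compat; lra).
  set (V := (PI / lam) ^ m). assert (HV : 0 < V) by (apply pow_lt; exact HPl).
  set (y := eta / 4) in *. assert (Hy : 0 < y <= / 4) by (unfold y; lra).
  (* The value y = eta / 4 minimises [- y * eta + 2 * y ^ 2], the tail exponent per site. *)
  assert (Hmy : INR m * (- y * eta + 2 * y ^ 2) <= - 4).
  { unfold y. replace (INR m * (- (eta / 4) * eta + 2 * (eta / 4) ^ 2))
      with (- (INR m * eta ^ 2) / 8) by field. lra. }
  assert (He4 : exp (-4) <= / 16).
  { change (-4) with (- (4)). rewrite exp_Ropp. apply Rinv_le_contravar; [lra|].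
    replace 4 with (INR 4 * 1) by (simpl; ring). rewrite exp_INR_mult.
    pose proof (exp_ineq1 1 ltac:(lra)).
    apply Rle_trans with (2 ^ 4); [simpl; lra|]. apply pow_incr. lra. }
  assert (Hup : forall c, 0 < c -> 0 <= g c <= (PI / c) ^ m).
  { intros c Hc. unfold g. rewrite pow_mult.
    split; [apply pow_le, pow2_ge_0|]. apply pow_incr. split; [apply pow2_ge_0|].
    apply gauss_box_sq_bounds, Hc. }
  assert (Hratio : forall z, -1 < z -> (PI / (lam * (1 + z))) ^ m = V * exp (- (INR m * ln (1 + z)))).
  { intros z Hz. replace (PI / (lam * (1 + z))) with (PI / lam * / (1 + z)) by (field; lra).
    rewrite Rpow_mult_distr. fold V. f_equal.
    replace (- (INR m * ln (1 + z))) with (INR m * ln (/ (1 + z))) by (rewrite ln_Rinv by lra; ring).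
    rewrite exp_INR_mult, exp_ln; [reflexivity|]. apply Rinv_0_lt_compat. lra. }
  (* Loss from the finite box: lam K^2 >= 4 m gives m exp (- lam K^2) <= 1/4, and Bernoulli's
     inequality applies. Removing two tails of 1/16 leaves more than 1/2. *)
  assert (H1 : 3 / 4 * V <= g lam).
  { unfold g. rewrite pow_mult.
    pose proof (gauss_box_sq_bounds K lam Hlam) as [Hlo _].
    set (q := exp (- (lam * INR K ^ 2))) in *.
    assert (Hq : INR m * q <= / 4).
    { pose proof (exp_ineq1_le (lam * INR K ^ 2)) as He.
      assert (Hx : 4 * INR m <= lam * INR K ^ 2).
      { rewrite <- HlC. replace (4 * (lam * C)) with (lam * (4 * C)) by ring.
        apply Rmult_le_compat_l; lra. }
      unfold q. rewrite exp_Ropp. apply Rmult_le_reg_r with (exp (lam * INR K ^ 2)); [apply exp_pos|].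
      rewrite Rmult_assoc, Rinv_l; [lra|apply Rgt_not_eq, exp_pos]. }
    assert (Hq01 : 0 <= q <= 1).
    { split; [left; apply exp_pos|]. unfold q. rewrite <- exp_0. apply exp_le_compat.
      pose proof (Rmult_le_pos lam (INR K ^ 2) ltac:(lra) (pow2_ge_0 _)). lra. }
    apply Rle_trans with ((PI / lam * (1 - q)) ^ m).
    - rewrite Rpow_mult_distr. fold V. pose proof (bernoulli_sub q m Hq01). nra.
    - apply pow_incr. split; [apply Rmult_le_pos; lra|exact Hlo]. }
  assert (H2 : exp (- (mu * (C * (1 + eta)))) * g (lam - mu) <= / 16 * V).
  { replace (lam - mu) with (lam * (1 + - y)) by (unfold mu; ring).
    apply Rle_trans with (exp (- (mu * (C * (1 + eta)))) * (V * exp (- (INR m * ln (1 + - y))))).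
    - apply Rmult_le_compat_l; [left; apply exp_pos|]. rewrite <- Hratio by lra.
      apply Hup. apply Rmult_lt_0_compat; lra.
    - rewrite (Rmult_comm V), <- Rmult_assoc, <- exp_plus. apply Rmult_le_compat_r; [lra|].
      eapply Rle_trans; [apply exp_le_compat|exact He4].
      replace (mu * (C * (1 + eta))) with (INR m * (y * (1 + eta)))
        by (rewrite <- HlC; unfold mu; ring).
      pose proof (ln_1_minus_ge y ltac:(lra)) as Hln. unfold Rminus in Hln.
      assert (INR m * (- y + - (2 * y ^ 2)) <= INR m * ln (1 + - y)) by (apply Rmult_le_compat_l; lra).
      lra. }
  assert (H3 : exp (mu * (C * (1 - eta))) * g (lam + mu) <= / 16 * V).
  { replace (lam + mu) with (lam * (1 + y)) by (unfold mu; ring).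
    apply Rle_trans with (exp (mu * (C * (1 - eta))) * (V * exp (- (INR m * ln (1 + y))))).
    - apply Rmult_le_compat_l; [left; apply exp_pos|]. rewrite <- Hratio by lra.
      apply Hup. apply Rmult_lt_0_compat; lra.
    - rewrite (Rmult_comm V), <- Rmult_assoc, <- exp_plus. apply Rmult_le_compat_r; [lra|].
      eapply Rle_trans; [apply exp_le_compat|exact He4].
      replace (mu * (C * (1 - eta))) with (INR m * (y * (1 - eta)))
        by (rewrite <- HlC; unfold mu; ring).
      pose proof (ln_1_plus_ge y ltac:(lra)) as Hln.
      assert (INR m * (y - y ^ 2) <= INR m * ln (1 + y)) by (apply Rmult_le_compat_l; lra).
      pose proof (pow2_ge_0 y).
      assert (0 <= INR m * y ^ 2) by (apply Rmult_le_pos; lra).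
      lra. }
  fold V. lra.
Qed.

(** * Asymptotics *)

(** The mass U left for the other sites falls short of B n (1 - a) by a relative amount of at most
    [kappa B a] / sqrt n. *)
Definition kappa (B a : R) : R := (sqrt B + / 2) / (B * (1 - a)).

(** 13 = 12 + 1: two losses of 6 sqrt m, from the lower window edge and from C < U, and 1 from n = m
    + 1, which also produces the absolute value. Then come the gradient, 32 = 16 * 2 from the
    windows and the Chernoff bracket, and the shortfall of U. *)
Definition lower_const (beta B h a : R) (D : nat) : R :=
  13 + Rabs (ln (PI * B) + ln (1 - a)) + 8 * beta * INR D * B / h ^ 2 + ln 32 + 2 * kappa B a.

(** The other sites get Gaussians of precision lam = m / C, whose total mass concentrates near C.
    The main term exp (lam C) (pi / lam)^m = (pi e C / m)^m is to leading order the volume of the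
    ball of squared radius C in dimension 2 m. *)
Lemma Zpart_lower (m : nat) (adj : nat -> nat -> bool) (beta B h a : R) (D : nat) :
  0 <= beta -> 0 < B -> 0 < h -> 0 <= a < 1 ->
  simple_graph (S m) adj -> max_degree_is (S m) adj D ->
  36 <= INR m -> 4 <= B * INR (S m) -> 2 * kappa B a <= sqrt (INR (S m)) ->
  exp (INR (S m) * (phi (beta * B ^ 2) a + ln (PI * B) + 1)
       - lower_const beta B h a D * sqrt (INR (S m)))
  <= Zpart (S m) adj h beta B.
Proof.
  intros Hb HB Hh Ha Hg Hd Hm HBN Hkap.
  pose proof (S_INR m) as HSm. set (N := INR (S m)) in *. set (M := INR m) in *.
  set (sN := sqrt N) in *.
  assert (HsN2 : sN * sN = N) by (apply sqrt_sqrt; lra).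
  assert (HsN1 : 1 <= sN) by (rewrite <- sqrt_1; apply sqrt_le_1_alt; lra).
  set (b := 1 - a) in *. assert (Hbb : 0 < b <= 1) by (unfold b; lra).
  assert (HBb : 0 < B * b) by (apply Rmult_lt_0_compat; lra).
  set (kap := kappa B a) in *.
  assert (Hkb : kap * (B * b) = sqrt B + / 2) by (unfold kap, kappa; fold b; field; lra).
  pose proof (sqrt_pos B) as HsB.
  assert (Hkap0 : 0 <= kap) by (apply Rdiv_le_0_compat; fold b; lra).
  set (U := B * N * b - sqrt (B * N * a) - / 2).
  set (y := kap / sN).
  assert (Hy : 0 <= y <= / 2).
  { unfold y. split; [apply Rdiv_le_0_compat; lra|apply Rle_div_l; lra]. }
  assert (HysN : y * sN = kap) by (unfold y; field; lra).
  assert (HU : N * (B * b * (1 - y)) <= U).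
  { assert (Hs : sqrt (B * N * a) <= sqrt B * sN).
    { unfold sN. rewrite <- sqrt_mult by lra. apply sqrt_le_1_alt. nra. }
    assert (N * (B * b) * y = (sqrt B + / 2) * sN) by (rewrite <- Hkb, <- HysN, <- HsN2; ring).
    unfold U. lra. }
  (* Makes M eta^2 = 36, above the required 32, at a cost M eta of only 6 sqrt M; eta <= 1 is where
     M >= 36 is used. *)
  set (eta := 6 / sqrt M).
  assert (HsM : 6 <= sqrt M).
  { rewrite <- (sqrt_pow2 6) by lra. apply sqrt_le_1_alt. lra. }
  assert (HsM2 : sqrt M * sqrt M = M) by (apply sqrt_sqrt; lra).
  assert (Heta : 0 < eta <= 1).
  { unfold eta. split; [apply Rdiv_lt_0_compat; lra|apply Rle_div_l; lra]. }
  assert (HMeta : M * eta = 6 * sqrt M).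
  { rewrite <- HsM2 at 1. unfold eta. field. lra. }
  assert (HMeta2 : M * eta ^ 2 = 36).
  { replace (M * eta ^ 2) with (M * eta * eta) by ring. rewrite HMeta. unfold eta. field. lra. }
  (* Chosen so that the upper window edge C (1 + eta) is exactly the available mass U. *)
  set (C := U / (1 + eta)).
  assert (HUpos : 0 < U).
  { apply Rlt_le_trans with (2 := HU). repeat apply Rmult_lt_0_compat; lra. }
  assert (HC : 0 < C) by (apply Rdiv_lt_0_compat; lra).
  assert (HCU : C * (1 + eta) = U) by (unfold C; field; lra).
  assert (HUBN : U <= B * N).
  { unfold U. pose proof (sqrt_pos (B * N * a)). nra. }
  pose proof (boxK_bounds (S m) B HB) as HK. fold N in HK.
  set (K := boxK (S m) B) in *.
  assert (HK2 : 4 * C <= INR K ^ 2) by nra.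
  pose proof (tilt_bracket_ge K m C eta HC Heta) as HW. fold M in HW. cbv zeta in HW.
  specialize (HW ltac:(lra) HK2).
  set (lam := M / C) in *.
  assert (Hlam : 0 < lam) by (apply Rdiv_lt_0_compat; lra).
  assert (HlC : lam * C = M) by (unfold lam; field; lra).
  pose proof PI_RGT_0 as HPI.
  assert (HPl : 0 < PI / lam) by (apply Rdiv_lt_0_compat; lra).
  assert (HV : 0 < (PI / lam) ^ m) by (apply pow_lt; exact HPl).
  pose proof (Zpart_ge_tilt m adj beta B h a (C * (1 - eta)) (C * (1 + eta)) lam (lam * (eta / 4)) D)
    as HZ. cbv zeta in HZ. fold N K in HZ.
  eapply Rle_trans; [|apply HZ; auto; try lra].
  2:{ split; [apply Rmult_le_pos; lra|]. nra. }
  2:{ rewrite HCU. unfold U, b. lra. }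
  apply Rle_trans with (exp (N * (beta * B ^ 2 * a ^ 2) - 8 * beta * INR D * B / h ^ 2)
    * (exp (lam * (C * (1 - eta))) * (/ 32 * (PI / lam) ^ m))).
  2:{ apply Rmult_le_compat_l; [left; apply exp_pos|].
      apply Rmult_le_compat_l; [left; apply exp_pos|]. lra. }
  rewrite <- (exp_ln (/ 32)) by lra. rewrite ln_Rinv by lra.
  rewrite <- (exp_ln (PI / lam)), <- exp_INR_mult by exact HPl. fold M.
  rewrite <- !exp_plus. apply exp_le_compat.
  replace (lam * (C * (1 - eta))) with (M - 6 * sqrt M) by (rewrite <- HMeta, <- HlC; ring).
  assert (HPB : 0 < PI * B) by (apply Rmult_lt_0_compat; lra).
  assert (Hln : ln (PI * B) + ln b - 2 * y - eta <= ln (PI / lam)).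
  { assert (Hle : PI * B * b * (1 - y) * / (1 + eta) <= PI / lam).
    { replace (PI / lam) with (PI * (U / M) * / (1 + eta)).
      - apply Rmult_le_compat_r; [left; apply Rinv_0_lt_compat; lra|].
        rewrite !Rmult_assoc. apply Rmult_le_compat_l; [lra|].
        apply (Rle_div_r _ _ M); [lra|]. eapply Rle_trans; [|exact HU].
        assert (0 <= B * b * (1 - y)) by (apply Rmult_le_pos; lra).
        replace (B * (b * (1 - y)) * M) with (M * (B * b * (1 - y))) by ring.
        apply Rmult_le_compat_r; lra.
      - unfold lam, C. field. lra. }
    apply Rle_trans with (ln (PI * B * b * (1 - y) * / (1 + eta))).
    - assert (0 < / (1 + eta)) by (apply Rinv_0_lt_compat; lra).
      assert (0 < PI * B * b) by (apply Rmult_lt_0_compat; lra).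
      assert (0 < PI * B * b * (1 - y)) by (apply Rmult_lt_0_compat; lra).
      rewrite !ln_mult, ln_Rinv by lra.
      pose proof (ln_1_minus_ge y Hy). pose proof (ln_le_sub1 (1 + eta) ltac:(lra)). nra.
    - apply ln_le; [|exact Hle]. apply Rmult_lt_0_compat; [|apply Rinv_0_lt_compat; lra].
      apply Rmult_lt_0_compat; [|lra]. apply Rmult_lt_0_compat; lra. }
  assert (HM : M * (ln (PI * B) + ln b - 2 * y - eta) <= M * ln (PI / lam))
    by (apply Rmult_le_compat_l; lra).
  assert (HMy : M * y <= kap * sN).
  { replace (kap * sN) with (N * y) by (rewrite <- HysN, <- HsN2; ring).
    apply Rmult_le_compat_r; lra. }
  assert (HsMN : sqrt M <= sN) by (apply sqrt_le_1_alt; lra).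
  assert (Hln32 : 0 <= ln 32) by (rewrite <- ln_1; apply ln_le; lra).
  assert (Hc0 : 0 <= 8 * beta * INR D * B / h ^ 2).
  { apply Rdiv_le_0_compat; [|apply pow_lt, Hh].
    pose proof (pos_INR D). repeat apply Rmult_le_pos; lra. }
  pose proof (Rle_abs (ln (PI * B) + ln b)) as Habs.
  pose proof (Rabs_pos (ln (PI * B) + ln b)) as Habs0.
  unfold lower_const, phi. fold b kap.
  set (A := Rabs (ln (PI * B) + ln b)) in *.
  set (c0 := 8 * beta * INR D * B / h ^ 2) in *.
  assert (1 + A + c0 + ln 32 <= (1 + A + c0 + ln 32) * sN) by nra.
  rewrite HSm. lra.
Qed.

(** For the logarithm: ln x <= x - 1 at x = N^(3/10), where 3/10 = 1/2 - 1/5. *)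
Lemma Rpower_quotients (N : R) :
  1 <= N ->
  / sqrt N <= Rpower N (- (1 / 5)) /\
  / N <= Rpower N (- (1 / 5)) /\
  ln N / sqrt N <= 10 / 3 * Rpower N (- (1 / 5)).
Proof.
  intros HN.
  assert (Hs : / sqrt N = Rpower N (- (1 / 2))).
  { rewrite Rpower_Ropp. f_equal. replace (1 / 2) with (/ 2) by field. rewrite Rpower_sqrt; lra. }
  split; [|split].
  - rewrite Hs. apply Rle_Rpower; lra.
  - rewrite <- (Rpower_1 N) at 1 by lra. rewrite <- Rpower_Ropp. apply Rle_Rpower; lra.
  - unfold Rdiv at 1. rewrite Hs.
    assert (H : ln N <= 10 / 3 * Rpower N (3 / 10)).
    { assert (H0 : 0 < Rpower N (3 / 10)) by apply exp_pos.
      pose proof (ln_le_sub1 _ H0) as H. unfold Rpower in H at 1. rewrite ln_exp in H. lra. }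
    apply Rle_trans with (10 / 3 * Rpower N (3 / 10) * Rpower N (- (1 / 2))).
    + apply Rmult_le_compat_r; [left; apply exp_pos|exact H].
    + rewrite Rmult_assoc, <- Rpower_plus. right. do 2 f_equal. lra.
Qed.

Lemma ln_entropy (B : R) : 0 < B -> ln (B * PI * exp 1) = ln (PI * B) + 1.
Proof.
  intros HB. pose proof PI_RGT_0.
  rewrite (ln_mult (B * PI)), ln_exp, (Rmult_comm B PI);
    [reflexivity|apply Rmult_lt_0_compat; lra|apply exp_pos].
Qed.

(** Positivity of Z is exported as well: the upper bound takes logarithms of an inequality with Z on
    the smaller side. *)
Lemma ln_Zpart_lower (beta B h : R) (D : nat) :
  0 <= beta -> 0 < B -> 0 < h ->
  exists C, 0 < C /\ forall (n : nat) (adj : nat -> nat -> bool),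
    simple_graph n adj -> max_degree_is n adj D -> C < INR n ->
    - C * Rpower (INR n) (- (1 / 5)) <= ln (Zpart n adj h beta B) / INR n - Ffree beta B
    /\ 0 < Zpart n adj h beta B.
Proof.
  intros Hb HB Hh. destruct (gain_attained (beta * B ^ 2)) as (a & Ha & Hphi).
  set (q := lower_const beta B h a D). set (k := kappa B a).
  (* The first three summands secure m >= 36, B n >= 4 and 2 kappa <= sqrt n; the last one is the
     rate. *)
  exists (37 + 4 / B + (2 * k) ^ 2 + Rabs q).
  pose proof (pow2_ge_0 (2 * k)) as Hk2. pose proof (Rabs_pos q) as Hq0.
  assert (HB4 : 0 < 4 / B) by (apply Rdiv_lt_0_compat; lra).
  split; [lra|]. intros n adj Hg Hd Hn.
  destruct n as [|m]; [simpl in Hn; lra|].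
  pose proof (S_INR m) as HSm. set (N := INR (S m)) in *.
  assert (HsN : 0 < sqrt N) by (apply sqrt_lt_R0; lra).
  assert (HsN2 : sqrt N * sqrt N = N) by (apply sqrt_sqrt; lra).
  pose proof PI_RGT_0 as HPI.
  assert (HZ : exp (N * Ffree beta B - q * sqrt N) <= Zpart (S m) adj h beta B).
  { rewrite Ffree_gain, <- Hphi.
    replace (ln (B * PI * exp 1) + phi (beta * B ^ 2) a) with (phi (beta * B ^ 2) a + ln (PI * B) + 1).
    - apply Zpart_lower; auto; fold N; [lra| |].
      + rewrite Rmult_comm. apply (Rle_div_l 4 N B HB). lra.
      + fold k. apply Rle_trans with (Rabs (2 * k)); [apply Rle_abs|].
        rewrite <- sqrt_Rsqr_abs. apply sqrt_le_1_alt. unfold Rsqr. nra.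
    - rewrite ln_entropy by exact HB. ring. }
  assert (HZ0 : 0 < Zpart (S m) adj h beta B) by (eapply Rlt_le_trans; [apply exp_pos|exact HZ]).
  split; [|exact HZ0].
  apply ln_le in HZ; [|apply exp_pos]. rewrite ln_exp in HZ.
  destruct (Rpower_quotients N ltac:(lra)) as (H1 & _ & _).
  set (X := Rpower N (- (1 / 5))) in *. assert (HX : 0 < X) by apply exp_pos.
  apply Rle_trans with (- Rabs q * / sqrt N).
  - apply Rle_trans with (- Rabs q * X); [nra|].
    rewrite !Ropp_mult_distr_l_reverse. apply Ropp_le_contravar, Rmult_le_compat_l; lra.
  - apply Rle_trans with (- (q * / sqrt N)).
    + assert (0 < / sqrt N) by (apply Rinv_0_lt_compat; exact HsN).
      pose proof (Rle_abs q). nra.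
    + cut (Ffree beta B - q * / sqrt N <= ln (Zpart (S m) adj h beta B) / N); [lra|].
      apply (Rle_div_r _ _ N); [lra|].
      replace ((Ffree beta B - q * / sqrt N) * N)
        with (N * Ffree beta B - q * (/ sqrt N * (sqrt N * sqrt N))) by (rewrite HsN2; ring).
      replace (/ sqrt N * (sqrt N * sqrt N)) with (sqrt N) by (field; lra). exact HZ.
Qed.

Lemma ln_Zpart_upper (beta B h : R) (D : nat) :
  0 <= beta -> 0 < B -> 0 < h ->
  exists C, 0 < C /\ forall (n : nat) (adj : nat -> nat -> bool),
    simple_graph n adj -> max_degree_is n adj D -> (0 < n)%nat ->
    0 < Zpart n adj h beta B ->
    ln (Zpart n adj h beta B) / INR n - Ffree beta B <= C * Rpower (INR n) (- (1 / 5)).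
Proof.
  intros Hb HB Hh. set (t := beta * B ^ 2).
  assert (Ht : 0 <= t) by (apply Rmult_le_pos; [lra|apply pow2_ge_0]).
  pose proof PI_RGT_0 as HPI.
  assert (HPB : 0 < PI * B) by (apply Rmult_lt_0_compat; lra).
  set (q := 4 * (B + 2) / sqrt (PI * B)).
  assert (Hq : 0 < q) by (apply Rdiv_lt_0_compat; [lra|apply sqrt_lt_R0, HPB]).
  assert (HbB : 0 <= beta * B) by (apply Rmult_le_pos; lra).
  (* 20 B is 6 B * 10/3, the cost of the large sites, and the lone 10/3 belongs to the ln n from the
     number of terms. *)
  exists (20 * B + beta * B + 3 * t + 10 / 3 + q). split; [lra|].
  intros n adj Hg Hd Hn HZ0.
  pose proof (Zpart_upper n adj beta B h D Hn Hb HB Hh Hg Hd) as HZ.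
  apply ln_le in HZ; [|exact HZ0]. rewrite ln_exp in HZ.
  assert (HN : 1 <= INR n) by (apply (le_INR 1); lia).
  unfold upper_exponent in HZ. fold t q in HZ. set (N := INR n) in *.
  destruct (Rpower_quotients N HN) as (H1 & H2 & H3).
  set (X := Rpower N (- (1 / 5))) in *.
  assert (HsN1 : 1 <= sqrt N) by (rewrite <- sqrt_1; apply sqrt_le_1_alt; lra).
  assert (HsN2 : sqrt N * sqrt N = N) by (apply sqrt_sqrt; lra).
  assert (HlnN : 0 <= ln N) by (rewrite <- ln_1; apply ln_le; lra).
  assert (HF : Ffree beta B = ln (PI * B) + 1 + gain t).
  { rewrite Ffree_gain, ln_entropy by exact HB. reflexivity. }
  assert (HlN : ln N / N <= 10 / 3 * X).
  { eapply Rle_trans; [|exact H3]. apply Rmult_le_compat_l; [exact HlnN|].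
    apply Rinv_le_contravar; nra. }
  apply Rle_trans with (6 * B * (ln N / sqrt N) + beta * B * / sqrt N + 3 * t * / N
     + ln N / N + q * / N).
  - apply Rle_minus_l. apply Rle_div_l; [lra|].
    replace ((6 * B * (ln N / sqrt N) + beta * B * / sqrt N + 3 * t * / N
       + ln N / N + q * / N + Ffree beta B) * N)
      with (6 * B * sqrt N * ln N + beta * B * sqrt N + 3 * t + ln N + q + N * Ffree beta B).
    + rewrite HF. lra.
    + assert (Hs : / sqrt N * N = sqrt N) by (rewrite <- HsN2 at 2; field; lra).
      transitivity (6 * B * ln N * (/ sqrt N * N) + beta * B * (/ sqrt N * N) + 3 * t * (/ N * N)
        + ln N * (/ N * N) + q * (/ N * N) + N * Ffree beta B).
      * rewrite Hs, Rinv_l by lra. ring.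
      * unfold Rdiv. ring.
  - assert (6 * B * (ln N / sqrt N) <= 6 * B * (10 / 3 * X)) by (apply Rmult_le_compat_l; lra).
    assert (beta * B * / sqrt N <= beta * B * X) by (apply Rmult_le_compat_l; lra).
    assert (3 * t * / N <= 3 * t * X) by (apply Rmult_le_compat_l; lra).
    assert (q * / N <= q * X) by (apply Rmult_le_compat_l; lra).
    lra.
Qed.

Theorem theorem2p1 :
  forall (beta B eps h : R) (D : nat),
    0 <= beta -> 0 < B -> 0 < eps < 1 / 5 -> 0 < h ->
    exists C : R, 0 < C /\
      forall (n : nat) (adj : nat -> nat -> bool),
        simple_graph n adj -> max_degree_is n adj D -> C < INR n ->
        let q := ln (Zpart n adj h beta B) / INR n - Ffree beta B in
        - C * Rpower (INR n) (- (1 / 5)) - C * / (INR n * h ^ 2) <= q /\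
        (beta * B ^ 2 <= theta_c ->
           q <= C * Rpower (INR n) (- (1 / 5) + eps)
                + C * Rpower (INR n) (- (4 * eps / 5))) /\
        (theta_c < beta * B ^ 2 ->
           q <= C * Rpower (INR n) (- (1 / 5) + eps)).
Proof.
  intros beta B eps h D Hb HB Heps Hh.
  destruct (ln_Zpart_lower beta B h D Hb HB Hh) as (C1 & HC1 & Hlo).
  destruct (ln_Zpart_upper beta B h D Hb HB Hh) as (C2 & HC2 & Hup).
  (* The summand 1 forces n > 1, so that powers of n increase with the exponent. *)
  exists (C1 + C2 + 1). split; [lra|]. intros n adj Hg Hd Hn q.
  destruct (Hlo n adj Hg Hd ltac:(lra)) as [H1 HZ]. fold q in H1.
  assert (Hn0 : (0 < n)%nat) by (apply INR_lt; simpl; lra).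
  pose proof (Hup n adj Hg Hd Hn0 HZ) as H2. fold q in H2.
  assert (HX0 : 0 < Rpower (INR n) (- (1 / 5))) by apply exp_pos.
  assert (HX : Rpower (INR n) (- (1 / 5)) <= Rpower (INR n) (- (1 / 5) + eps))
    by (apply Rle_Rpower; lra).
  assert (HY : 0 < Rpower (INR n) (- (4 * eps / 5))) by apply exp_pos.
  assert (Hinv : 0 < / (INR n * h ^ 2)).
  { apply Rinv_0_lt_compat, Rmult_lt_0_compat; [lra|apply pow_lt, Hh]. }
  assert (Hq : q <= (C1 + C2 + 1) * Rpower (INR n) (- (1 / 5) + eps)) by nra.
  split; [nra|]. split; intros _; nra.
Qed.
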